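(* Let $(C,\mathbf A)$, with $C\in\mathcal L(\mathcal X,\mathcal Y)$ and $\mathbf A=(A_1,\dots,A_d)\in\mathcal L(\mathcal X)^d$, be a contractive pair and let $S$ be an $\mathcal L(\mathcal U,\mathcal Y)$-valued function defined on $\mathbb B^d$. Then $$K_S(\lambda,\zeta)=K_{C,\mathbf A}(\lambda,\zeta)\qquad(\lambda,\zeta\in\mathbb B^d)$$ holds (and therefore also $S$ belongs to $\mathcal S_d(\mathcal U,\mathcal Y)$) if and only if the operator $$V=\begin{bmatrix}A_V&B_V\\ C_V&D_V\end{bmatrix}:\begin{bmatrix}\mathcal D\\ \mathcal Y\end{bmatrix}\to\begin{bmatrix}\mathcal X\\ \mathcal U\end{bmatrix}$$ with entries $A_V=A^*|_{\mathcal D}$, $B_V=C^*$, $D_V=S(0)^*$, and $C_V:\mathcal D\to\mathcal U$ determined by linearity and continuity from $$C_V:\ Z(\zeta)^*(I-A^*Z(\zeta)^* )^{-1}C^*y\mapsto (S(\zeta)^*-S(0)^* )y\qquad(\zeta\in\mathbb B^d,\ y\in\mathcal Y),$$ is (well defined and) an isometry from $\mathcal D\oplus\mathcal Y$ onto $$\mathcal R_V=\overline{\operatorname{span}}\left\{\begin{bmatrix}(I-A^*Z(\zeta)^* )^{-1}C^*y\\ S(\zeta)^*y\end{bmatrix}:\ \zeta\in\mathbb B^d,\ y\in\mathcal Y\right\}\subset\begin{bmatrix}\mathcal X\\ \mathcal U\end{bmatrix}.$$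
   Context: $\mathcal U,\mathcal Y,\mathcal X$ are Hilbert spaces and $\mathcal L(\cdot,\cdot)$ denotes bounded linear operators. $\mathbb B^d$ is the open unit ball of $\mathbb C^d$ with inner product $\langle\lambda,\zeta\rangle=\sum_j\lambda_j\overline{\zeta_j}$; $\mathcal H(k_d)$ is the reproducing kernel Hilbert space on $\mathbb B^d$ with kernel $k_d(\lambda,\zeta)=1/(1-\langle\lambda,\zeta\rangle)$ and $\mathcal H_{\mathcal Y}(k_d)=\mathcal H(k_d)\otimes\mathcal Y$, viewed as a space of $\mathcal Y$-valued functions. $\mathcal S_d(\mathcal U,\mathcal Y)$ is the set of $\mathcal L(\mathcal U,\mathcal Y)$-valued analytic functions $S$ on $\mathbb B^d$ such that $f\mapsto S f$ is a contraction from $\mathcal H_{\mathcal U}(k_d)$ into $\mathcal H_{\mathcal Y}(k_d)$. Put $K_S(\lambda,\zeta)=\dfrac{I_{\mathcal Y}-S(\lambda)S(\zeta)^*}{1-\langle\lambda,\zeta\rangle}$. The pair $(C,\mathbf A)$ is contractive if $A_1^*A_1+\cdots+A_d^*A_d+C^*C\le I_{\mathcal X}$. Put $$K_{C,\mathbf A}(\lambda,\zeta)=C(I-\lambda_1A_1-\cdots-\lambda_dA_d)^{-1}(I-\overline{\zeta_1}A_1^*-\cdots-\overline{\zeta_d}A_d^* )^{-1}C^* .$$ $A:\mathcal X\to\mathcal X^d$ is the column operator with entries $A_1,\dots,A_d$, $Z(\lambda)=[\lambda_1I_{\mathcal X}\ \cdots\ \lambda_dI_{\mathcal X}]:\mathcal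 X^d\to\mathcal X$, and $$\mathcal D=\overline{\operatorname{span}}\{Z(\zeta)^*(I-A^*Z(\zeta)^* )^{-1}C^*y:\ \zeta\in\mathbb B^d,\ y\in\mathcal Y\}\subset\mathcal X^d .$$ *)

(* Defs.v *)
From HB Require Import structures.
From mathcomp Require Import all_boot all_order all_algebra.
From mathcomp Require Import sesquilinear complex ring.
From mathcomp Require Import boolp classical_sets functions reals.
From mathcomp Require Import topology normedtype.

Set Implicit Arguments.
Unset Strict Implicit.
Unset Printing Implicit Defensive.

Import Order.TTheory GRing.Theory Num.Theory.
Import numFieldNormedType.Exports.

Local Open Scope classical_set_scope.
Local Open Scope ring_scope.

HB.mixin Record CompleteNormedModule_isHilbert (K : numClosedFieldType) H
    & CompleteNormedModule K H := {
  hdot : {dot H for @Num.conj K};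
  hdotE : forall x : H, hdot x x = `|x| ^+ 2
}.

(* The inner product is linear in its first argument. *)
#[short(type="hilbertType")]
HB.structure Definition Hilbert (K : numClosedFieldType) :=
  {H of CompleteNormedModule_isHilbert K H & CompleteNormedModule K H}.

Notation "''[' x , y ]" := (hdot x y) : ring_scope.

Section DotNorm.
Variables (K : numClosedFieldType) (V : lmodType K).
Variable f : {dot V for @Num.conj K}.

Let f_ge0 u : 0 <= f u u.
Proof.
have [->|u0] := eqVneq u 0; first by rewrite linear0r.
exact/ltW/neq0_dnorm_gt0.
Qed.

Let fC x y : f y x = (f x y)^*.
Proof. by rewrite hermC expr0 mul1r. Qed.

Let fZl a x y : f (a *: x) y = a * f x y.
Proof. exact: linearZl_LR. Qed.

Let fZr a x y : f x (a *: y) = a^* * f x y.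
Proof. exact: linearZr_LR. Qed.

Lemma dot_CauchySchwarz u v : `|f u v| <= sqrtC (f u u) * sqrtC (f v v).
Proof.
have [->|v0] := eqVneq v 0.
  by rewrite linear0r normr0 mulr_ge0 // sqrtC_ge0.
have fv0 : 0 < f v v by exact: neq0_dnorm_gt0.
rewrite -sqrtCM ?nnegrE// -[leLHS]sqrCK // ler_sqrtC ?nnegrE ?mulr_ge0 ?exprn_ge0//.
pose a := f u v / f v v.
have := f_ge0 (u - a *: v).
have -> : f (u - a *: v) (u - a *: v) = f u u - `|f u v| ^+ 2 / f v v.
  rewrite linearBl /= !linearBr /= !(fZl, fZr) (fC u v) /a rmorphM /= fmorphV /=.
  rewrite (conj_Creal (ger0_real (f_ge0 v))) normCK.
  have := lt0r_neq0 fv0; set p := f u v; set q := p^*; set r := f v v => r0.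
  set s := f u u.
  by field.
by rewrite subr_ge0 ler_pdivrMr.
Qed.

Lemma dot_ler_normD u v :
  sqrtC (f (u + v) (u + v)) <= sqrtC (f u u) + sqrtC (f v v).
Proof.
have s0 x : 0 <= sqrtC (f x x) by rewrite sqrtC_ge0.
rewrite -(@ler_pXn2r _ 2) ?nnegrE ?addr_ge0// sqrtCK sqrrD !sqrtCK.
rewrite linearDl /= !linearDr /= (fC u v).
rewrite addrA lerD2r -addrA lerD2l.
apply: le_trans (_ : `|f u v + (f u v)^*| <= _).
  by apply: real_ler_norm; rewrite CrealE rmorphD /= conjCK addrC.
rewrite (le_trans (ler_normD _ _))// norm_conjC -mulr2n lerMn2r /=.
exact: dot_CauchySchwarz.
Qed.

Lemma dot_normrZ a u : sqrtC (f (a *: u) (a *: u)) = `|a| * sqrtC (f u u).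
Proof.
rewrite fZl fZr mulrA -normCK sqrtCM ?nnegrE ?exprn_ge0//.
by rewrite sqrCK.
Qed.

Lemma dot_normr0_eq0 u : sqrtC (f u u) = 0 -> u = 0.
Proof.
move/eqP; rewrite sqrtC_eq0 => fu0; apply/eqP; apply: contraTT fu0 => u0.
exact/lt0r_neq0/neq0_dnorm_gt0.
Qed.

End DotNorm.

Lemma contraction_cauchy_cvg (K : numFieldType) (V : normedModType K)
    (W : completeNormedModType K) (g : V -> W) (F : set_system V) :
  (forall u v, `|g u - g v| <= `|u - v|) ->
  ProperFilter F -> cauchy F -> exists w : W, g @ F --> w.
Proof.
move=> gc FF Fc; apply/cvg_ex; apply: cauchy_cvg; apply: cauchy_exP => e e0.
have [x Fx] := (cauchyP F).1 Fc e e0; exists (g x).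
apply: (@filterS _ F _ (ball x e) (g @^-1` ball (g x) e)) Fx => y.
rewrite /= -!ball_normE /= => xy; exact: le_lt_trans (gc x y) xy.
Qed.

Definition hsum (K : numClosedFieldType) (X Y : hilbertType K) : Type :=
  (X * Y)%type.

Definition hpow (K : numClosedFieldType) (d : nat) (X : hilbertType K) : Type :=
  {ffun 'I_d -> X}.

Section DirectSum.
Variables (K : numClosedFieldType) (X Y : hilbertType K).

HB.instance Definition _ := GRing.Lmodule.copy (hsum X Y) (X * Y)%type.

Definition hsum_dot (p q : hsum X Y) : K := '[p.1, q.1] + '[p.2, q.2].

Let hsum_bilinear :
  bilinear_for *%R (GRing.Scale.Law.clone _ _ (@Num.conj K \; *%R) _) hsum_dot.
Proof.
split=> [q a p p'|p a q q']; rewrite /hsum_dot /=.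
  by rewrite !linearDl /= !linearZl_LR mulrDr addrACA.
by rewrite !linearDr /= !linearZr_LR /= mulrDr addrACA.
Qed.

HB.instance Definition _ :=
  bilinear_isBilinear.Build K (hsum X Y) (hsum X Y) K _ _ hsum_dot hsum_bilinear.

Let hsum_herm p q : hsum_dot p q = (-1) ^+ false * (hsum_dot q p)^*.
Proof.
by rewrite /hsum_dot rmorphD /= expr0 mul1r; congr (_ + _);
  rewrite hermC expr0 mul1r.
Qed.

HB.instance Definition _ := isHermitianSesquilinear.Build K (hsum X Y)
  false (@Num.conj K) hsum_dot hsum_herm.

Let hsum_gt0 p : p != 0 -> 0 < hsum_dot p p.
Proof.
rewrite /hsum_dot !hdotE => p0.
rewrite lt0r addr_ge0 ?exprn_ge0// andbT paddr_eq0 ?exprn_ge0//.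
by rewrite !sqrf_eq0 !normr_eq0; apply: contra p0 => /andP[? ?]; exact/andP.
Qed.

HB.instance Definition _ := isDotProduct.Build K (hsum X Y) hsum_dot hsum_gt0.

HB.instance Definition _ := Lmodule_isNormed.Build K (hsum X Y)
  (dot_ler_normD hsum_dot) (dot_normrZ hsum_dot) (@dot_normr0_eq0 _ _ hsum_dot).

Lemma hsum_normE (p : hsum X Y) : `|p| = sqrtC (`|p.1| ^+ 2 + `|p.2| ^+ 2).
Proof. by rewrite -!hdotE. Qed.

Let norm1 (p : hsum X Y) : `|p.1| <= `|p|.
Proof.
rewrite hsum_normE -[leLHS]sqrCK // ler_sqrtC ?nnegrE ?addr_ge0 ?exprn_ge0//.
by rewrite lerDl exprn_ge0.
Qed.

Let norm2 (p : hsum X Y) : `|p.2| <= `|p|.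
Proof.
rewrite hsum_normE -[leLHS]sqrCK // ler_sqrtC ?nnegrE ?addr_ge0 ?exprn_ge0//.
by rewrite lerDr exprn_ge0.
Qed.

Let norm_le (p : hsum X Y) : `|p| <= `|p.1| + `|p.2|.
Proof.
rewrite hsum_normE -[leRHS]sqrCK ?addr_ge0//.
rewrite ler_sqrtC ?nnegrE ?addr_ge0 ?exprn_ge0 ?addr_ge0//.
by rewrite sqrrD lerD2r lerDl mulrn_wge0 // mulr_ge0.
Qed.

Let hsum_complete (F : set_system (hsum X Y)) :
  ProperFilter F -> cauchy F -> cvg F.
Proof.
move=> FF Fc.
have [x Fx] := @contraction_cauchy_cvg K (hsum X Y) X
  (fun p => p.1) F (fun u v => norm1 (u - v)) FF Fc.
have [y Fy] := @contraction_cauchy_cvg K (hsum X Y) Y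
  (fun p => p.2) F (fun u v => norm2 (u - v)) FF Fc.
apply/cvg_ex; exists ((x, y) : hsum X Y); apply/cvgrPdist_lt => e e0.
have e2 : 0 < e / 2 by rewrite divr_gt0.
have /cvgrPdist_lt/(_ _ e2) Fx2 := Fx.
have /cvgrPdist_lt/(_ _ e2) Fy2 := Fy.
apply: filterS2 Fx2 Fy2 => p px py.
by rewrite (le_lt_trans (norm_le _))// (splitr e) ltrD.
Qed.

HB.instance Definition _ := Uniform_isComplete.Build (hsum X Y) hsum_complete.

Let hsum_dotE (p : hsum X Y) : hsum_dot p p = `|p| ^+ 2.
Proof. by rewrite hsum_normE sqrtCK /hsum_dot !hdotE. Qed.

HB.instance Definition _ := CompleteNormedModule_isHilbert.Build K (hsum X Y)
  hsum_dotE.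

End DirectSum.

Section DirectPower.
Variables (K : numClosedFieldType) (d : nat) (X : hilbertType K).

HB.instance Definition _ :=
  GRing.Lmodule.copy (hpow d X) {ffun 'I_d -> X}.

Definition hpow_dot (p q : hpow d X) : K := \sum_(j < d) '[p j, q j].

Let hpow_bilinear :
  bilinear_for *%R (GRing.Scale.Law.clone _ _ (@Num.conj K \; *%R) _) hpow_dot.
Proof.
split=> [q a p p'|p a q q']; rewrite /hpow_dot /= mulr_sumr -big_split /=;
  apply: eq_bigr => j _; rewrite !ffunE.
  by rewrite !linearDl /= !linearZl_LR.
by rewrite !linearDr /= !linearZr_LR.
Qed.

HB.instance Definition _ :=
  bilinear_isBilinear.Build K (hpow d X) (hpow d X) K _ _ hpow_dot hpow_bilinear.

Let hpow_herm p q : hpow_dot p q = (-1) ^+ false * (hpow_dot q p)^*.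
Proof.
rewrite /hpow_dot expr0 mul1r rmorph_sum /=; apply: eq_bigr => j _.
by rewrite hermC expr0 mul1r.
Qed.

HB.instance Definition _ := isHermitianSesquilinear.Build K (hpow d X)
  false (@Num.conj K) hpow_dot hpow_herm.

Let sumsq_ge0 (p : hpow d X) : 0 <= \sum_(j < d) `|p j| ^+ 2.
Proof. by apply: sumr_ge0 => j _; rewrite exprn_ge0. Qed.

Let hpow_dotsq (p : hpow d X) : hpow_dot p p = \sum_(j < d) `|p j| ^+ 2.
Proof. by apply: eq_bigr => j _; rewrite hdotE. Qed.

Let hpow_gt0 p : p != 0 -> 0 < hpow_dot p p.
Proof.
rewrite hpow_dotsq lt0r sumsq_ge0 andbT; apply: contra => /eqP p0.
apply/eqP/ffunP => j; rewrite ffunE; apply/eqP.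
have sq0 i : true -> 0 <= `|p i| ^+ 2 by rewrite exprn_ge0.
by rewrite -normr_eq0 -sqrf_eq0 (psumr_eq0P sq0 p0).
Qed.

HB.instance Definition _ := isDotProduct.Build K (hpow d X) hpow_dot hpow_gt0.

HB.instance Definition _ := Lmodule_isNormed.Build K (hpow d X)
  (dot_ler_normD hpow_dot) (dot_normrZ hpow_dot) (@dot_normr0_eq0 _ _ hpow_dot).

Lemma hpow_normE (p : hpow d X) : `|p| = sqrtC (\sum_(j < d) `|p j| ^+ 2).
Proof. by rewrite -hpow_dotsq. Qed.

Let norm_coord (j : 'I_d) (p : hpow d X) : `|p j| <= `|p|.
Proof.
rewrite hpow_normE -[leLHS]sqrCK // ler_sqrtC ?nnegrE ?exprn_ge0//.
by rewrite (bigD1 j)//= lerDl sumr_ge0// => i _; rewrite exprn_ge0.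
Qed.

Let norm_le (p : hpow d X) : `|p| <= \sum_(j < d) `|p j|.
Proof.
have S0 : 0 <= \sum_(j < d) `|p j| by rewrite sumr_ge0.
rewrite hpow_normE -[leRHS]sqrCK// ler_sqrtC ?nnegrE ?exprn_ge0//.
rewrite expr2 mulr_suml ler_sum// => j _; rewrite expr2 ler_wpM2l//.
by rewrite (bigD1 j)//= lerDl sumr_ge0.
Qed.

Let hpow_complete (F : set_system (hpow d X)) :
  ProperFilter F -> cauchy F -> cvg F.
Proof.
move=> FF Fc.
have coordB j (u v : hpow d X) : `|u j - v j| <= `|u - v|.
  by rewrite (le_trans _ (norm_coord j _))// !ffunE.
have Fx (j : 'I_d) := @contraction_cauchy_cvg K (hpow d X) X (fun p => p j) F
  (coordB j) FF Fc.
pose x : hpow d X := [ffun j => projT1 (cid (Fx j))].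
apply/cvg_ex; exists x; apply/cvgrPdist_lt => e e0.
have ed : 0 < e / d.+1%:R by rewrite divr_gt0.
have xF : F [set p : hpow d X | forall j, `|x j - p j| < e / d.+1%:R].
  apply: filter_forall => j; rewrite ffunE; case: (cid (Fx j)) => /= y Fy.
  by move/cvgrPdist_lt : Fy; exact.
apply: filterS xF => p xp; rewrite (le_lt_trans (norm_le _))//.
rewrite (@le_lt_trans _ _ (\sum_(j < d) e / d.+1%:R))//.
  by apply: ler_sum => j _; rewrite !ffunE ltW//; have := xp j; rewrite ffunE.
rewrite sumr_const card_ord -[_ *+ d]mulr_natl mulrA ltr_pdivrMr// mulrC.
by rewrite ltr_pM2l// ltr_nat.
Qed.

HB.instance Definition _ := Uniform_isComplete.Build (hpow d X) hpow_complete.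

Let hpow_dotE (p : hpow d X) : hpow_dot p p = `|p| ^+ 2.
Proof. by rewrite hpow_normE sqrtCK hpow_dotsq. Qed.

HB.instance Definition _ := CompleteNormedModule_isHilbert.Build K (hpow d X)
  hpow_dotE.

End DirectPower.

Section Operators.
Variable K : numClosedFieldType.
Implicit Types H G : hilbertType K.

(* Bounded operators are continuous linear maps; for these the set below is a
   singleton by the Riesz representation theorem. *)
Definition adjoint H G (T : H -> G) (y : G) : H :=
  get [set z | forall x, '[T x, y] = '[x, z]].

(* The inverse of [T] when [T] is bijective. *)
Definition opinv H (T : H -> H) (y : H) : H := get [set x | T x = y].

Definition op_ge0 H (T : H -> H) : Prop := forall x, 0 <= '[T x, x].

Definition lspan (V : lmodType K) (G : set V) : set V :=
  [set v | exists n (a : 'I_n -> K) (g : 'I_n -> V),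
     (forall i, G (g i)) /\ v = \sum_(i < n) a i *: g i].

Definition clspan H (G : set H) : set H := closure (lspan G).

Definition linear_on (V W : lmodType K) (D : set V) (f : V -> W) : Prop :=
  forall (a : K) u v, D u -> D v -> f (a *: u + v) = a *: f u + f v.

(* Only used for [T] linear on the subspace [D], so that preserving the norm is
   preserving the distance. *)
Definition isometry_onto H G (D : set H) (T : H -> G) (E : set G) : Prop :=
  (forall x, D x -> `|T x| = `|x|) /\ T @` D = E.

End Operators.

Section Ball.
Variables (K : numClosedFieldType) (d : nat).
Implicit Types l z : 'rV[K]_d.

Definition cinner l z : K := \sum_(j < d) l 0 j * (z 0 j)^*.

Definition cball : set 'rV[K]_d := [set l | cinner l l < 1].

Definition kd l z : K := (1 - cinner l z)^-1.

End Ball.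

Section Schur.
Variable K : numClosedFieldType.

(* [H], viewed through [ev] as a space of scalar functions on [Om], is the
   reproducing kernel Hilbert space with kernel [k]. *)
Definition is_rkhs (T : Type) (Om : set T) (k : T -> T -> K)
    (H : hilbertType K) (ev : H -> T -> K) : Prop :=
  [/\ forall t, Om t -> scalar (fun f => ev f t),
      forall f, (forall t, Om t -> ev f t = 0) -> f = 0 &
      forall s, Om s -> exists ks : H,
        (forall t, Om t -> ev ks t = k t s) /\ forall f, ev f s = '[f, ks]].

Definition is_tensor (H Y E : hilbertType K) (tens : {bilinear H -> Y -> E}) :
    Prop :=
  (forall f g y z, '[tens f y, tens g z] = '[f, g] * '[y, z]) /\
  clspan [set tens f y | f in setT & y in setT] = setT.

(* [E] is the Hilbert tensor product of the reproducing kernel Hilbert space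
   with kernel [k] and [Y], viewed through [ev] as a space of [Y]-valued
   functions on [Om]. *)
Definition is_vrkhs (T : Type) (Om : set T) (k : T -> T -> K)
    (Y E : hilbertType K) (ev : E -> T -> Y) : Prop :=
  exists (H : hilbertType K) (ev0 : H -> T -> K)
         (tens : {bilinear H -> Y -> E}),
    [/\ is_rkhs Om k ev0,
        is_tensor tens,
        forall t, Om t -> linear (fun f => ev f t),
        forall t, Om t -> continuous (fun f => ev f t) &
        forall f y t, Om t -> ev (tens f y) t = ev0 f t *: y].

Variables (d : nat) (U Y : hilbertType K).
Implicit Type S : 'rV[K]_d -> {linear U -> Y}.

(* Complex differentiability on the ball for the operator norm, the derivative
   at [l0] being h |-> \sum_j h_j L_j. *)
Definition op_analytic S : Prop :=
  forall l0, @cball K d l0 ->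
  exists L : 'I_d -> {linear U -> Y},
    (forall j, continuous (L j)) /\
    forall e : K, 0 < e -> \forall l \near l0, forall u,
      `|S l u - S l0 u - \sum_(j < d) (l 0 j - l0 0 j) *: L j u|
      <= e * `|l - l0| * `|u|.

(* Any two realizations of a space H(k_d) (x) Y are identified by a unitary
   operator commuting with the evaluations, so that the quantification over
   realizations does not matter. *)
Definition schur_class S : Prop :=
  op_analytic S /\
  forall (EU EY : hilbertType K) (evU : EU -> 'rV[K]_d -> U)
         (evY : EY -> 'rV[K]_d -> Y),
    is_vrkhs (@cball K d) (@kd K d) evU ->
    is_vrkhs (@cball K d) (@kd K d) evY ->
    forall f : EU, exists g : EY,
      (forall l, cball l -> evY g l = S l (evU f l)) /\ `|g| <= `|f|.

End Schur.

Section Colligation.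
Variables (K : numClosedFieldType) (d : nat) (U Y X : hilbertType K).
Variables (C : X -> Y) (A : 'I_d -> X -> X) (S : 'rV[K]_d -> U -> Y).
Implicit Types l z : 'rV[K]_d.

Definition contractive_pair : Prop :=
  op_ge0 (fun x => x - (\sum_(j < d) adjoint (A j) (A j x) + adjoint C (C x))).

Definition KS l z (y : Y) : Y :=
  kd l z *: (y - S l (adjoint (S z) y)).

Definition KCA l z (y : Y) : Y :=
  C (opinv (fun x => x - \sum_(j < d) l 0 j *: A j x)
      (opinv (fun x => x - \sum_(j < d) (z 0 j)^* *: adjoint (A j) x)
        (adjoint C y))).

Definition Acol (x : X) : hpow d X := [ffun j => A j x].

Definition Zrow l (p : hpow d X) : X := \sum_(j < d) l 0 j *: p j.

Definition rvec z (y : Y) : X :=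
  opinv (fun x => x - adjoint Acol (adjoint (Zrow z) x)) (adjoint C y).

Definition Dgen z (y : Y) : hpow d X := adjoint (Zrow z) (rvec z y).

Definition Dspace : set (hpow d X) :=
  clspan [set Dgen z y | z in @cball K d & y in setT].

Definition RVspace : set (hsum X U) :=
  clspan [set ((rvec z y, adjoint (S z) y) : hsum X U)
         | z in @cball K d & y in setT].

(* [CV] is the linear continuous map on [Dspace] with the prescribed values on
   the generators; it is unique on [Dspace]. *)
Definition is_CV (CV : hpow d X -> U) : Prop :=
  [/\ linear_on Dspace CV,
      {within Dspace, continuous CV} &
      forall z y, cball z ->
        CV (Dgen z y) = adjoint (S z) y - adjoint (S 0) y].

Definition Vop (CV : hpow d X -> U) (p : hsum (hpow d X) Y) : hsum X U :=
  (adjoint Acol p.1 + adjoint C p.2, CV p.1 + adjoint (S 0) p.2).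

(* The existence of [CV] expresses that V is well defined. *)
Definition V_isometry : Prop :=
  exists CV : hpow d X -> U, is_CV CV /\
    isometry_onto [set p : hsum (hpow d X) Y | Dspace p.1] (Vop CV) RVspace.

End Colligation.

(* Main.v *)
(* Write r = (I - A^* Z(z)^* )^-1 C^* y.  Multiplying K_S = K_(C,A) by the
   denominator 1 - <l, z> turns it into the equality of the Gram matrices of
   the families (Z(z)^* r, y) and (r, S(z)^* y), indexed by z in the ball and y
   in Y.  V maps the first family to the second, and the point z = 0 shows that
   the first one spans D (+) Y.  Hence V is an isometry onto R_V iff the Gram
   matrices agree, by polarization in one direction and by extending the
   correspondence of generators to closed spans in the other.

   The same extension principle gives the membership in the Schur class.  The
   adjoint of V provides B with S(l) = S(0) + C (I - Z(l) A)^-1 Z(l) B, which is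
   analytic by the resolvent identity; and comparing the reproducing vectors
   k_z y with the pairs (k_z S(z)^* y, r) yields an isometry whose adjoint,
   restricted to the first summand, is multiplication by S. *)

Require Import Defs.
From HB Require Import structures.
From mathcomp Require Import all_boot all_order all_algebra.
From mathcomp Require Import sesquilinear complex ring.
From mathcomp Require Import boolp classical_sets functions reals interval_inference.
From mathcomp Require Import topology normedtype.

Set Implicit Arguments.
Unset Strict Implicit.
Unset Printing Implicit Defensive.

Import Order.TTheory GRing.Theory Num.Theory.
Import numFieldNormedType.Exports.

Local Open Scope classical_set_scope.
Local Open Scope ring_scope.

(** * Inner products and closed spans *)

Section Dot.
Variables (K : numClosedFieldType).
Implicit Types H G : hilbertType K.

Lemma hdotC H (x y : H) : '[y, x] = ('[x, y])^*.
Proof. by rewrite hermC expr0 mul1r. Qed.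

Lemma hdotDl H (x y z : H) : '[x + y, z] = '[x, z] + '[y, z].
Proof. exact: linearDl. Qed.

Lemma hdotDr H (x y z : H) : '[z, x + y] = '[z, x] + '[z, y].
Proof. exact: linearDr. Qed.

Lemma hdotZl H a (x z : H) : '[a *: x, z] = a * '[x, z].
Proof. exact: linearZl_LR. Qed.

Lemma hdotZr H a (x z : H) : '[z, a *: x] = a^* * '[z, x].
Proof. exact: linearZr_LR. Qed.

Lemma hdotBl H (x y z : H) : '[x - y, z] = '[x, z] - '[y, z].
Proof. exact: linearBl. Qed.

Lemma hdotBr H (x y z : H) : '[z, x - y] = '[z, x] - '[z, y].
Proof. exact: linearBr. Qed.

Lemma hdotNr H (x z : H) : '[z, - x] = - '[z, x].
Proof. exact: linearNr. Qed.

Lemma hdot0l H (z : H) : '[0, z] = 0.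
Proof. exact: linear0l. Qed.

Lemma hdot0r H (z : H) : '[z, 0] = 0.
Proof. exact: linear0r. Qed.

Lemma hdot_suml H n (F : 'I_n -> H) z : '[\sum_(i < n) F i, z] = \sum_(i < n) '[F i, z].
Proof. exact: (big_morph (hdot^~ z) (fun x y => hdotDl x y z) (hdot0l z)). Qed.

Lemma hdot_sumr H n (F : 'I_n -> H) z : '[z, \sum_(i < n) F i] = \sum_(i < n) '[z, F i].
Proof. exact: (big_morph (hdot z) (fun x y => hdotDr x y z) (hdot0r z)). Qed.

Lemma hdot_eq0 H (x : H) : '[x, x] = 0 -> x = 0.
Proof. by rewrite hdotE => /eqP; rewrite sqrf_eq0 normr_eq0 => /eqP. Qed.

Lemma hdotP H (x y : H) : (forall v, '[x, v] = '[y, v]) -> x = y.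
Proof.
move=> xy; apply/eqP; rewrite -subr_eq0; apply/eqP/hdot_eq0.
by rewrite hdotBl xy subrr.
Qed.

Lemma hdot_CS H (x y : H) : `|'[x, y]| <= `|x| * `|y|.
Proof.
have := dot_CauchySchwarz hdot x y.
by rewrite !hdotE !sqrCK.
Qed.

Lemma hsum_dotE (X Y : hilbertType K) (p q : hsum X Y) :
  '[p, q] = '[p.1, q.1] + '[p.2, q.2].
Proof. by []. Qed.

Lemma hpow_dotE d (X : hilbertType K) (p q : hpow d X) :
  '[p, q] = \sum_(j < d) '[p j, q j].
Proof. by []. Qed.

(** * Closures, completeness and linear spans *)

Lemma closure_normP (V : normedModType K) (P : set V) x :
  closure P x <-> (forall e : K, 0 < e -> exists2 u, P u & `|x - u| < e).
Proof.
split=> [cx e e0|h B].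
  have [u [Pu xu]] := cx _ (nbhsx_ballx x e e0).
  by exists u => //; rewrite -ball_normE in xu.
move/nbhs_ballP => [e /= e0 eB]; have [u Pu xu] := h e e0.
by exists u; split=> //; apply: eB; rewrite -ball_normE.
Qed.

(* Cantor's intersection theorem, for sets that need not be closed. *)
Lemma nested_complete (V : completeNormedModType K) (E : K -> set V) :
  (forall e, 0 < e -> E e !=set0) ->
  (forall e f, 0 < e -> e <= f -> E e `<=` E f) ->
  (forall e, 0 < e -> exists2 f, 0 < f & forall u v, E f u -> E f v -> `|u - v| < e) ->
  exists p, forall e f, 0 < e -> 0 < f -> exists2 u, E f u & `|p - u| < e.
Proof.
move=> E0 Emono Ediam.
pose F := filter_from [set e : K | 0 < e] E.
have FF : ProperFilter F.
  apply: filter_from_proper; last by move=> e; exact: E0.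
  apply: filter_from_filter; first by exists 1; exact: ltr01.
  move=> e f /= e0 f0.
  have [ef|fe] := real_leP (gtr0_real e0) (gtr0_real f0).
    by exists e => // x ex; split=> //; exact: Emono ex.
  by exists f => // x fx; split=> //; apply: Emono fx => //; exact: ltW.
have : cauchy F.
  apply: cauchy_exP => e e0; have [f f0 fE] := Ediam e e0.
  have [u Eu] := E0 f f0; exists u; exists f => //= v Ev.
  by rewrite -ball_normE; exact: fE.
move/cauchy_cvg/cvg_ex => [p Fp]; exists p => e f e0 f0.
have Fpe : F (ball p e) := Fp _ (nbhsx_ballx p e e0).
rewrite -ball_normE in Fpe.
have : F (E f `&` [set t | `|p - t| < e]).
  by apply: filterI => //; exists f.
by move/filter_ex => [u [? ?]]; exists u.
Qed.

Lemma lspan_mem (V : lmodType K) (G : set V) g : G g -> lspan G g.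
Proof.
move=> Gg; exists 1, (fun=> 1), (fun=> g); split=> //.
by rewrite big_ord1 scale1r.
Qed.

Lemma lspan0 (V : lmodType K) (G : set V) : lspan G 0.
Proof.
exists 0, (fun=> 0), (fun=> 0); split; first by case.
by rewrite big_ord0.
Qed.

Lemma lspan_lin (V : lmodType K) (G : set V) (a : K) u v :
  lspan G u -> lspan G v -> lspan G (a *: u + v).
Proof.
move=> [n [b [g [Gg ->]]]] [m [c [h [Gh ->]]]].
exists (n + m)%N,
 (fun i => match fintype.split i with inl j => a * b j | inr j => c j end),
 (fun i => match fintype.split i with inl j => g j | inr j => h j end); split.
  by move=> i; case: (fintype.split i).
rewrite big_split_ord scaler_sumr; congr (_ + _); apply: eq_bigr => i _.
  by rewrite (fintype.unsplitK (inl i)) scalerA.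
by rewrite (fintype.unsplitK (inr i)).
Qed.

Lemma lspan_sub (V : lmodType K) (G P : set V) :
  G `<=` P -> P 0 -> (forall (a : K) u v, P u -> P v -> P (a *: u + v)) ->
  lspan G `<=` P.
Proof.
move=> GP P0 Pl _ [n [a [g [Gg ->]]]].
elim: n a g Gg => [|n IH] a g Gg; first by rewrite big_ord0.
rewrite big_ord_recl; apply: Pl; first exact: GP.
by apply: IH => i; exact: Gg.
Qed.

Lemma clspan_sub H (G P : set H) :
  G `<=` P -> P 0 -> (forall (a : K) u v, P u -> P v -> P (a *: u + v)) ->
  closed P -> clspan G `<=` P.
Proof.
move=> GP P0 Pl /closure_id ->; apply: closureS; exact: lspan_sub.
Qed.

Lemma clspan_mem H (G : set H) g : G g -> clspan G g.
Proof. by move=> Gg; apply: subset_closure; exact: lspan_mem. Qed.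

Lemma clspan_lin H (G : set H) (a : K) u v :
  clspan G u -> clspan G v -> clspan G (a *: u + v).
Proof.
move=> /closure_normP Gu /closure_normP Gv; apply/closure_normP => e e0.
have a1 : 0 < `|a| + 1 by rewrite ltr_wpDl.
have [u' Gu' uu'] := Gu (e / 2 / (`|a| + 1)) ltac:(by rewrite !divr_gt0).
have [v' Gv' vv'] := Gv (e / 2) ltac:(by rewrite divr_gt0).
exists (a *: u' + v'); first exact: lspan_lin.
rewrite opprD addrACA -scalerBr (le_lt_trans (ler_normD _ _))//.
rewrite (splitr e) ler_ltD// normrZ.
rewrite (@le_trans _ _ ((`|a| + 1) * `|u - u'|))//.
  by rewrite ler_wpM2r// lerDl.
by rewrite mulrC -ler_pdivlMr// ltW.
Qed.

Lemma bounded_linear_continuous (V W : normedModType K) (f : V -> W) (c : K) :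
  (forall a u v, f (a *: u + v) = a *: f u + f v) ->
  0 < c -> (forall x, `|f x| <= c * `|x|) -> continuous f.
Proof.
move=> fl c0 fc x; apply/(@cvgrPdist_lt _ W) => e e0.
near=> y.
have -> : f x - f y = f (x - y) by rewrite addrC -scaleN1r -fl scaleN1r addrC.
rewrite (le_lt_trans (fc _))// mulrC -ltr_pdivlMr//.
near: y.
have := nbhsx_ballx x (e / c) ltac:(by rewrite divr_gt0).
by rewrite -ball_normE.
Unshelve. all: by end_near. Qed.

Lemma closed_kernel (V W : normedModType K) (f : V -> W) :
  continuous f -> closed [set x | f x = 0].
Proof.
move=> fc; apply: (@preimage_closed _ _ f [set 0]); first by move=> ? _; exact: fc.
apply: accessible_closed_set1; apply: hausdorff_accessible; exact: norm_hausdorff.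
Qed.

Lemma closed_orth H (v : H) : closed [set x | '[x, v] = 0].
Proof.
apply: (@closed_kernel H K^o); apply: (@bounded_linear_continuous H K^o _ (`|v| + 1)).
- by move=> a u w; rewrite hdotDl hdotZl.
- by rewrite ltr_wpDl.
- move=> x; rewrite (le_trans (hdot_CS _ _))// mulrC ler_wpM2r//.
  by rewrite lerDl.
Qed.

Lemma clspan_orth H (G : set H) (v : H) :
  (forall g, G g -> '[g, v] = 0) -> forall x, clspan G x -> '[x, v] = 0.
Proof.
move=> Gv; apply: clspan_sub => //.
- by rewrite /= hdot0l.
- by move=> a x y /= xv yv; rewrite hdotDl hdotZl xv yv mulr0 addr0.
- exact: closed_orth.
Qed.

Lemma orth_sym H (x v : H) : '[x, v] = 0 -> '[v, x] = 0.
Proof. by move=> h; rewrite hdotC h rmorph0. Qed.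

(** Expanding [|f (a *: x + y)|] squared for every scalar [a] compares [a '[f x, f y]] plus its
    conjugate with the same expression in [x] and [y]. The choices [a = 1] and [a = 'i] isolate the
    real and imaginary parts. *)
Lemma polarization H G (f : H -> G) (D : set H) :
  (forall (a : K) u v, D u -> D v -> D (a *: u + v)) ->
  (forall (a : K) u v, D u -> D v -> f (a *: u + v) = a *: f u + f v) ->
  (forall x, D x -> `|f x| = `|x|) ->
  forall x y, D x -> D y -> '[f x, f y] = '[x, y].
Proof.
move=> Dl fl fn x y Dx Dy.
have h (a : K) : a * '[f x, f y] + a^* * ('[f x, f y])^* =
    a * '[x, y] + a^* * ('[x, y])^*.
  have := fn _ (Dl a _ _ Dx Dy); rewrite fl// => /(congr1 (fun t => t ^+ 2)).
  rewrite -!hdotE !hdotDl !hdotDr !hdotZl !hdotZr !hdotE !fn//.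
  rewrite -(hdotC (f x)) -(hdotC x) => e.
  apply: (addrI (a * (a^* * `|x| ^+ 2) + `|y| ^+ 2)).
  rewrite addrACA [RHS]addrACA.
  transitivity (a * (a^* * `|x| ^+ 2) + a * '[f x, f y] +
      (a^* * '[f y, f x] + `|y| ^+ 2)).
    by rewrite [_ + `|y| ^+ 2]addrC.
  by rewrite e [`|y| ^+ 2 + _]addrC.
have h1 := h 1; have hi := h 'i.
rewrite !rmorph1 !mul1r in h1; rewrite conjCi !mulNr -!mulrBr in hi.
have hi' := mulfI (neq0Ci K) hi.
apply: (mulfI (_ : 2 != 0)); rewrite ?pnatr_eq0//.
have -> : 2 * '[f x, f y] =
    ('[f x, f y] + '[f x, f y]^*) + ('[f x, f y] - '[f x, f y]^*) by ring.
rewrite h1 hi'; ring.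
Qed.

End Dot.

Section DirectSum.
Variables (K : numClosedFieldType) (X Y : hilbertType K).

Lemma hsum_normsq (p : hsum X Y) : `|p| ^+ 2 = `|p.1| ^+ 2 + `|p.2| ^+ 2.
Proof. by rewrite hsum_normE sqrtCK. Qed.

Lemma hsum_norm1 (p : hsum X Y) : `|p.1| <= `|p|.
Proof. by rewrite -(@ler_pXn2r _ 2)// ?nnegrE// hsum_normsq lerDl exprn_ge0. Qed.

Lemma hsum_norm2 (p : hsum X Y) : `|p.2| <= `|p|.
Proof. by rewrite -(@ler_pXn2r _ 2)// ?nnegrE// hsum_normsq lerDr exprn_ge0. Qed.

Lemma hsum_norm_l (x : X) : `|((x, 0) : hsum X Y)| = `|x|.
Proof. by apply/eqP; rewrite -(@eqrXn2 _ 2)// hsum_normsq /= normr0 expr0n addr0. Qed.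

Lemma hsum_norm_r (y : Y) : `|((0, y) : hsum X Y)| = `|y|.
Proof. by apply/eqP; rewrite -(@eqrXn2 _ 2)// hsum_normsq /= normr0 expr0n add0r. Qed.

End DirectSum.

(** * Projections, adjoints and Gram-equivalent families *)

Section Hilbert.
Local Open Scope complex_scope.
Variable R : realType.
Implicit Types H G : hilbertType R[i].

(** The order of [R[i]] is partial, so the infimum is taken over real parts; nonnegative values are
    real, hence nothing is lost. *)
Lemma complex_inf (T : Type) (L : set T) (F : T -> R[i]) :
  L !=set0 -> (forall u, 0 <= F u) ->
  exists2 m : R[i], (forall u, L u -> m <= F u) &
    forall e, 0 < e -> exists2 u, L u & F u <= m + e.
Proof.
move=> [u0 Lu0] F0.
pose E := [set complex.Re (F u) | u in L].
have FE u : F u = (complex.Re (F u))%:C by rewrite RRe_real// ger0_real.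
have Einf : has_inf E.
  split; first by exists (complex.Re (F u0)), u0.
  exists 0 => _ [u Lu <-]; by rewrite -lecR -FE.
exists (inf E)%:C => [u Lu|e e0].
  by rewrite FE lecR; apply: ge_inf; [case: Einf|exists u].
have eE : e = (complex.Re e)%:C by rewrite RRe_real// gtr0_real.
have e0' : 0 < complex.Re e by rewrite -ltcR -eE.
have [_ [u Lu <-] uE] := inf_adherent e0' Einf.
by exists u => //; rewrite FE eE -rmorphD lecR ltW.
Qed.

Lemma parallelogram H (u v : H) :
  `|u - v| ^+ 2 + `|u + v| ^+ 2 = 2 * `|u| ^+ 2 + 2 * `|v| ^+ 2.
Proof.
rewrite -!hdotE !hdotBl !hdotBr !hdotDl !hdotDr; ring.
Qed.

Lemma dist_line H (x g : H) : g != 0 ->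
  `|x - ('[x, g] / `|g| ^+ 2) *: g| ^+ 2 = `|x| ^+ 2 - `|'[x, g]| ^+ 2 / `|g| ^+ 2.
Proof.
move=> g0; have gn : `|g| ^+ 2 != 0 by rewrite sqrf_eq0 normr_eq0.
rewrite -[LHS]hdotE hdotBl !hdotBr !(hdotZl, hdotZr) !hdotE (hdotC x g).
rewrite rmorphM /= fmorphV /= (conj_Creal (ger0_real (exprn_ge0 2 (normr_ge0 g)))).
rewrite (normCK ('[x, g])) /=.
move: gn; set a := `|x| ^+ 2; set q := ('[x, g])^*; set r := `|g| ^+ 2.
set s := '[x, g] => r0.
by field.
Qed.

(** The near-minimizers of the distance from [x] to [lspan G] have small diameter by the
    parallelogram law, so they close in on a point [p]. If [x - p] were not orthogonal to [g],
    correcting a near-minimizer along [g] would push the squared distance below its infimum. *)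
Lemma projection H (G : set H) (x : H) :
  exists2 p, clspan G p & forall g, G g -> '[g, x - p] = 0.
Proof.
have [m m_le m_ad] := @complex_inf H (lspan G) (fun u => `|x - u| ^+ 2)
  (ex_intro _ 0 (lspan0 G)) (fun u => exprn_ge0 2 (normr_ge0 _)).
pose E (e : R[i]) : set H := [set u | lspan G u /\ `|x - u| ^+ 2 <= m + e].
have [p pE] : exists p, forall e f, 0 < e -> 0 < f -> exists2 u, E f u & `|p - u| < e.
  apply: nested_complete.
  - by move=> e e0; have [u ? ?] := m_ad e e0; exists u.
  - by move=> e f e0 ef u [Lu ue]; split=> //; rewrite (le_trans ue)// lerD2l.
  (* The midpoint of [u] and [v] has squared distance at least [m], so [|u - v|] squared is at most
     four times the excess, that is [e ^+ 2 / 2]. *)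
  - move=> e e0; exists (e ^+ 2 / 8); first by rewrite divr_gt0// exprn_gt0.
    move=> u v [Lu ue] [Lv ve].
    rewrite -(@ltr_pXn2r _ 2)// ?nnegrE// ?ltW//.
    have Lw : lspan G (2^-1 *: u + 2^-1 *: v).
      apply: lspan_lin => //; rewrite -[_ *: v]addr0.
      by apply: lspan_lin => //; exact: lspan0.
    have mw := m_le _ Lw.
    have e20 : 0 < e ^+ 2 by rewrite exprn_gt0.
    have := parallelogram (x - v) (x - u).
    have -> : x - v - (x - u) = u - v by rewrite opprB addrC addrA subrK.
    have -> : x - v + (x - u) = 2 *: (x - (2^-1 *: u + 2^-1 *: v)).
      rewrite scalerBr scalerDr !scalerA mulfV ?pnatr_eq0// !scale1r scaler_nat mulr2n.
      by rewrite opprD addrACA [- u - v]addrC.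
    rewrite normrZ exprMn normr_nat => pl.
    apply: (@le_lt_trans _ _ (2 * (m + e ^+ 2 / 8) + 2 * (m + e ^+ 2 / 8) - 4 * m)).
      rewrite lerBrDr; apply: (@le_trans _ _ (2 * `|x - v| ^+ 2 + 2 * `|x - u| ^+ 2)).
        by rewrite -pl lerD2l -natrX ler_wpM2l.
      by apply: lerD; rewrite ler_wpM2l.
    rewrite (_ : _ - _ = e ^+ 2 / 2); last by field.
    by rewrite ltr_pdivrMr// mulr_natr mulr2n ltrDl.
exists p.
  apply/closure_normP => e e0; have [u [Lu _] pu] := pE e 1 e0 ltr01.
  by exists u.
move=> g Gg; have [->|g0] := eqVneq g 0; first exact: hdot0l.
apply/orth_sym/eqP; rewrite -normr_le0; apply/negPn/negP => n0.
have gp : 0 < `|g| by rewrite normr_gt0.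
have pg0 : 0 < `|'[x - p, g]|.
  rewrite lt_neqAle normr_ge0 andbT eq_sym normr_eq0; apply: contra n0 => /eqP->.
  by rewrite normr0.
(* With this [e] the errors ['[x - u, g]] and ['[p - u, g]] each stay within half of ['[x - p, g]],
   the second strictly, which is contradictory. *)
have [e e0 eE] : exists2 e : R[i], 0 < e & e * `|g| = `|'[x - p, g]| / 2.
  exists (`|'[x - p, g]| / `|g| / 2); first by rewrite !divr_gt0.
  by rewrite mulrAC divfK ?gt_eqF.
have [u [Lu ue] pu] := pE e (e ^+ 2) e0 (exprn_gt0 2 e0).
have : `|'[x - u, g]| <= e * `|g|.
  have eg0 : 0 <= e * `|g| by rewrite mulr_ge0// (ltW e0).
  rewrite -(@ler_pXn2r _ 2)// ?nnegrE//.
  rewrite exprMn -ler_pdivrMr ?exprn_gt0//.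
  have Lu' : lspan G (('[x - u, g] / `|g| ^+ 2) *: g + u).
    by apply: lspan_lin => //; exact: lspan_mem.
  have := m_le _ Lu'; rewrite [_ *: g + u]addrC opprD addrA dist_line//.
  move=> h; rewrite -(lerD2l m); apply: le_trans ue.
  by rewrite -lerBrDr.
apply/negP; rewrite -real_ltNge ?realM ?normr_real// ?gtr0_real//.
have : `|'[x - p, g]| < `|'[x - u, g]| + e * `|g|.
  have -> : x - p = (x - u) - (p - u) by rewrite opprB addrA subrK.
  rewrite hdotBl (le_lt_trans (ler_normB _ _))// ltrD2l.
  by rewrite (le_lt_trans (hdot_CS _ _))// ltr_pM2r.
rewrite -ltrBlDr; apply: le_lt_trans.
by rewrite eE lerBrDr -splitr.
Qed.

Lemma le_of_sqr_le (a b : R[i]) : 0 <= a -> 0 <= b -> a ^+ 2 <= b * a -> a <= b.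
Proof.
move=> a0 b0; have [->//|an] := eqVneq a 0.
by rewrite expr2 ler_pM2r// lt_neqAle eq_sym an a0.
Qed.

(** With [p] the projection of [x], the vector [x - p] is orthogonal to [G], hence to both [x] and
    [p], so it vanishes. *)
Lemma clspan_biorth H (G : set H) (x : H) :
  (forall v, (forall g, G g -> '[g, v] = 0) -> '[x, v] = 0) -> clspan G x.
Proof.
move=> h; have [p Gp xp] := projection G x.
suff -> : x = p by [].
apply/eqP; rewrite -subr_eq0; apply/eqP/hdot_eq0.
by rewrite hdotBl h// (clspan_orth xp)// subr0.
Qed.

Lemma clspan_eq H (G : set H) (p q : H) :
  clspan G p -> clspan G q -> (forall g, G g -> '[g, p] = '[g, q]) -> p = q.
Proof.
move=> Gp Gq pq; apply/eqP; rewrite -subr_eq0; apply/eqP/hdot_eq0.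
apply: (@clspan_orth _ _ G); first by move=> g Gg; rewrite hdotBr pq// subrr.
by rewrite addrC -scaleN1r; exact: clspan_lin.
Qed.

(** If [phi] is not zero, subtracting from some [x0] its projection on the closed kernel leaves a
    vector [e] orthogonal to the kernel. Every [x] is a multiple of [e] modulo the kernel, which
    forces the scalar in front of [e]. *)
Lemma riesz H (phi : H -> R[i]) :
  (forall a u v, phi (a *: u + v) = a * phi u + phi v) ->
  closed [set x | phi x = 0] -> exists z, forall x, phi x = '[x, z].
Proof.
move=> phil phic.
have phi0 : phi 0 = 0.
  by have := phil (-1) 0 0; rewrite scaler0 addr0 mulN1r addNr.
have [[x0 /eqP phix0]|nx] := pselect (exists x, phi x <> 0); last first.
  exists 0 => x; rewrite hdot0r; apply: contrapT => h; apply: nx.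
  by exists x.
have [p Np xp] := projection [set x | phi x = 0] x0.
have phip : phi p = 0.
  have : clspan [set x | phi x = 0] `<=` [set x | phi x = 0].
    by apply: clspan_sub => // a u v /= u0 v0; rewrite phil u0 v0 mulr0 addr0.
  exact.
set e := x0 - p in xp.
have phie : phi e = phi x0.
  by rewrite /e addrC -scaleN1r phil phip mulr0 add0r.
have e0 : '[e, e] != 0.
  apply: contra phix0 => /eqP/hdot_eq0 e0.
  by rewrite -phie e0 phi0.
rewrite -phie in phix0.
exists ((phi e / '[e, e])^* *: e) => x.
rewrite hdotZr conjCK.
have := xp (x - (phi x / phi e) *: e).
rewrite /= addrC -scaleNr phil mulNr divfK// addNr => /(_ erefl).
rewrite hdotDl hdotZl mulNr addrC => /eqP; rewrite subr_eq0 => /eqP ->.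
by field; rewrite phix0 e0.
Qed.

(** Inner products separate points, so [get] in [adjoint] has no freedom. Explicit adjoints are
    computed through this. *)
Lemma adjoint_uniq H G (T : H -> G) y z :
  (forall x, '[T x, y] = '[x, z]) -> adjoint T y = z.
Proof.
move=> Tz; rewrite /adjoint.
have := @getI _ [set z | forall x, '[T x, y] = '[x, z]] z Tz.
set w := get _ => /= Tw.
by apply/hdotP => v; rewrite hdotC -Tw Tz -hdotC.
Qed.

Lemma adjointE H G (T : {linear H -> G}) : continuous T ->
  forall x y, '[T x, y] = '[x, adjoint T y].
Proof.
move=> Tc x y; have [||z Tz] := @riesz H (fun x => '[T x, y]).
- by move=> a u v; rewrite linearP hdotDl hdotZl.
- apply: (@preimage_closed _ _ T [set w | '[w, y] = 0]); last exact: closed_orth.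
  by move=> ? _; exact: Tc.
by rewrite (adjoint_uniq Tz) Tz.
Qed.

Lemma adjoint_linear H G (T : {linear H -> G}) : continuous T ->
  forall (a : R[i]) x y,
  adjoint T (a *: x + y) = a *: adjoint T x + adjoint T y.
Proof.
move=> Tc a x y; apply: adjoint_uniq => z.
by rewrite !hdotDr !hdotZr !adjointE.
Qed.

Lemma linear_bundle (V W : lmodType R[i]) (f : V -> W) :
  (forall a u v, f (a *: u + v) = a *: f u + f v) ->
  exists g : {linear V -> W}, g =1 f.
Proof.
move=> fl.
pose m := GRing.isLinear.Build _ _ _ _ f fl.
pose g : {linear V -> W} := HB.pack f m.
by exists g.
Qed.

(* Two families with the same Gram matrix are related by an isometry [g i |-> f i]
   between their closed spans; [p] is the image of [v] under its adjoint.  The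
   point [(p, q)] is the projection of [(0, 2v)] onto the closed span of the
   pairs [(g i, f i)], i.e. onto the graph of that isometry. *)
Lemma gram_transfer_point (I : Type) (J : set I) H G (g : I -> H) (f : I -> G) :
  (forall i j, J i -> J j -> '[g i, g j] = '[f i, f j]) ->
  forall v, exists p, [/\ clspan (g @` J) p,
    forall i, J i -> '[g i, p] = '[f i, v] & `|p| <= `|v| ].
Proof.
move=> gf v.
pose Gam := [set ((g i, f i) : hsum H G) | i in J].
have [[p q] GP Pv] := projection Gam ((0, 2 *: v) : hsum H G).
have gpq i : J i -> '[g i, p] = '[f i, q].
  move=> Ji; have : '[((p, q) : hsum H G), ((g i, - f i) : hsum H G)] = 0.
    apply: clspan_orth GP => _ [j Jj <-].
    by rewrite hsum_dotE /= hdotNr gf// subrr.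
  rewrite hsum_dotE /= hdotNr => /eqP; rewrite subr_eq0 => /eqP e.
  by rewrite hdotC e -hdotC.
have pq : `|p| = `|q|.
  have : '[((p, q) : hsum H G), ((p, - q) : hsum H G)] = 0.
    apply: clspan_orth GP => _ [j Jj <-].
    by rewrite hsum_dotE /= hdotNr gpq// subrr.
  rewrite hsum_dotE /= hdotNr !hdotE => /eqP; rewrite subr_eq0 => e.
  by apply/eqP; rewrite -(@eqrXn2 _ 2)// ?normr_ge0.
(* Orthogonality gives ['[g i, p] + '[f i, q] = 2 '[f i, v]], and the two terms on the left are
   equal; hence the factor 2 in the projected point. *)
have gpv i : J i -> '[g i, p] = '[f i, v].
  move=> Ji; have := Pv _ (ex_intro2 _ _ i Ji erefl).
  rewrite hsum_dotE /= add0r hdotNr hdotBr hdotZr conjC_nat -gpq// => e.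
  apply: (mulfI (_ : 2 != 0)); rewrite ?pnatr_eq0//.
  by apply/esym/eqP; rewrite -subr_eq0 -e; apply/eqP; ring.
exists p; split=> //.
  apply: clspan_biorth => w gw.
  have : '[((p, q) : hsum H G), ((w, 0) : hsum H G)] = 0.
    apply: clspan_orth GP => _ [j Jj <-].
    by rewrite hsum_dotE /= hdot0r addr0 gw//; exists j.
  by rewrite hsum_dotE /= hdot0r addr0.
(* This yields ['[p, p] = '[q, v]], and [|q| = |p|] turns Cauchy-Schwarz into the norm bound. *)
have : '[((p, q) : hsum H G), ((p, - v) : hsum H G)] = 0.
  apply: clspan_orth GP => _ [j Jj <-].
  by rewrite hsum_dotE /= hdotNr gpv// subrr.
rewrite hsum_dotE /= hdotNr hdotE => /eqP; rewrite subr_eq0 => /eqP e.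
have : `|p| ^+ 2 <= `|p| * `|v|.
  by rewrite -[leLHS](ger0_norm (exprn_ge0 2 (normr_ge0 p))) e pq hdot_CS.
have [->|p0] := eqVneq `|p| 0; first by rewrite normr_ge0.
by rewrite expr2 ler_pM2l// lt_neqAle eq_sym p0 normr_ge0.
Qed.

(** The point [p] lies in the closed span of the [g i] and is therefore determined by its inner
    products with them; this makes its choice linear in [v]. *)
Lemma gram_transfer (I : Type) (J : set I) H G (g : I -> H) (f : I -> G) :
  (forall i j, J i -> J j -> '[g i, g j] = '[f i, f j]) ->
  exists W : {linear G -> H}, forall v, [/\ clspan (g @` J) (W v),
    forall i, J i -> '[g i, W v] = '[f i, v] & `|W v| <= `|v| ].
Proof.
move=> gf; have /choice[W0 W0P] := gram_transfer_point gf.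
have [|W WE] := @linear_bundle G H W0.
  move=> a u v; apply: (@clspan_eq _ (g @` J)).
  - by case: (W0P (a *: u + v)).
  - by apply: clspan_lin; [case: (W0P u)|case: (W0P v)].
  - move=> _ [i Ji <-]; have [_ uE _] := W0P u; have [_ vE _] := W0P v.
    have [_ -> //] := W0P (a *: u + v).
    by rewrite !hdotDr !hdotZr uE// vE.
by exists W => v; rewrite WE.
Qed.

(* The lower bound makes the range closed, the last hypothesis makes it dense. *)
Lemma opinvK H (M : H -> H) (c C : R[i]) :
  (forall a u v, M (a *: u + v) = a *: M u + M v) ->
  0 < c -> (forall x, c * `|x| <= `|M x|) -> (forall x, `|M x| <= C * `|x|) ->
  (forall v, (forall x, '[M x, v] = 0) -> v = 0) ->
  cancel (opinv M) M /\ cancel M (opinv M).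
Proof.
move=> Ml c0 Mc MC Mv.
have MB u v : M (u - v) = M u - M v by rewrite addrC -scaleN1r Ml scaleN1r addrC.
have Minj : injective M.
  move=> x y xy; apply/eqP; rewrite -subr_eq0 -normr_le0 -(pmulr_rle0 _ c0).
  by rewrite (le_trans (Mc _))// MB xy subrr normr0.
have Msurj y : exists x, M x = y.
  have My : clspan (range M) y.
    apply: clspan_biorth => v h; rewrite (Mv v) ?hdot0r// => x.
    by apply: h; exists x.
  have Ma e : 0 < e -> exists x, `|M x - y| < e.
    move=> e0; have [_ [n [a [g [Gg ->]]]] xe] := (closure_normP _ _).1 My e e0.
    have /choice[h hE] : forall i, exists x, M x = g i.
      by move=> i; have [x _ <-] := Gg i; exists x.
    exists (\sum_(i < n) a i *: h i); rewrite distrC.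
    suff -> : M (\sum_(i < n) a i *: h i) = \sum_(i < n) a i *: g i by [].
    have [M' M'E] := linear_bundle Ml.
    rewrite -M'E linear_sum; apply: eq_bigr => i _.
    by rewrite linearZ /= M'E hE.
  pose E (e : R[i]) : set H := [set x | `|M x - y| < e].
  have [|||p pE] := @nested_complete _ H E.
  - by move=> e e0; have [x] := Ma e e0; exists x.
  - by move=> e f _ ef x; rewrite /E /= => /lt_le_trans; exact.
  (* Two such points have images less than [c * e] apart, and the lower bound divides this by
     [c]. *)
  - move=> e e0; exists (c * e / 2); first by rewrite divr_gt0// mulr_gt0.
    move=> u v; rewrite /E /= => uE vE.
    rewrite -(ltr_pM2l c0) (le_lt_trans (Mc _))//.
    have -> : M (u - v) = (M u - y) - (M v - y) by rewrite MB opprB addrA subrK.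
    rewrite (le_lt_trans (ler_normB _ _))// (splitr (c * e)) ltrD//.
  exists p; apply/eqP; rewrite -subr_eq0 -normr_le0; apply/negPn/negP => n0.
  have d0 : 0 < `|M p - y|.
    by rewrite lt_neqAle normr_ge0 andbT eq_sym; apply: contra n0 => /eqP->.
  have C1 : 0 < `|C| + 1 by rewrite ltr_wpDl.
  pose d := `|M p - y|.
  have [u uE pu] := pE (d / 2 / (`|C| + 1)) (d / 2)
    ltac:(by rewrite !divr_gt0) ltac:(by rewrite divr_gt0).
  (* [M p] is within [d / 2] of [M u], which is less than [d / 2] away from [y]; this contradicts
     [d = |M p - y|]. *)
  have : d < d / 2 + d / 2.
    rewrite {1}/d; have -> : M p - y = M (p - u) + (M u - y) by rewrite MB addrA subrK.
    rewrite (le_lt_trans (ler_normD _ _))// ler_ltD//.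
    rewrite (le_trans (MC _))//.
    have [->|pu0] := eqVneq `|p - u| 0; first by rewrite mulr0 divr_ge0// normr_ge0.
    have : C * `|p - u| <= `|C| * `|p - u|.
      rewrite ler_wpM2r//; apply: real_ler_norm; apply: ger0_real.
      have pu1 : 0 < `|p - u| by rewrite lt_neqAle eq_sym pu0 normr_ge0.
      by rewrite -(pmulr_lge0 _ pu1) (le_trans (normr_ge0 _) (MC _)).
    move/le_trans; apply; apply: (@le_trans _ _ ((`|C| + 1) * `|p - u|)).
      by rewrite ler_wpM2r// lerDl.
    by rewrite mulrC -ler_pdivlMr// ltW.
  by rewrite -splitr ltxx.
have invK : cancel (opinv M) M.
  move=> y; have [x Mx] := Msurj y; rewrite /opinv.
  exact: (@getI _ [set x | M x = y] x Mx).
by split=> // x; apply: Minj; rewrite invK.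
Qed.

(** The triangle inequality gives the bounds [1 - r] and [1 + r]. A vector [v] orthogonal to the
    range satisfies ['[v, v] = '[T v, v]], so its squared norm is at most [r] times itself. *)
Lemma opinv_contractionK H (T : H -> H) (r : R[i]) :
  (forall a u v, T (a *: u + v) = a *: T u + T v) ->
  r < 1 -> (forall x, `|T x| <= r * `|x|) ->
  cancel (opinv (fun x => x - T x)) (fun x => x - T x) /\
  cancel (fun x => x - T x) (opinv (fun x => x - T x)).
Proof.
move=> Tl r1 Tr; apply: (@opinvK _ _ (1 - r) (1 + r)).
- by move=> a u v; rewrite Tl scalerBr opprD addrACA.
- by rewrite subr_gt0.
- move=> x; rewrite mulrBl mul1r lerBlDr (le_trans _ (lerD (lexx _) (Tr x)))//.
  by rewrite -{1}(subrK (T x) x) ler_normD.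
- move=> x; rewrite mulrDl mul1r (le_trans (ler_normB _ _))//.
  by rewrite lerD2l.
- move=> v /(_ v) /eqP; rewrite hdotBl subr_eq0 => /eqP vv.
  apply/eqP; rewrite -normr_eq0; apply/negPn/negP => v0.
  have v1 : 0 < `|v| by rewrite lt_neqAle eq_sym v0 normr_ge0.
  have : `|v| ^+ 2 <= r * `|v| ^+ 2.
    rewrite -{1}(ger0_norm (exprn_ge0 2 (normr_ge0 v))) -{1}hdotE vv.
    by rewrite (le_trans (hdot_CS _ _))// expr2 mulrA ler_pM2r.
  rewrite -subr_ge0 -{2}(mul1r (`|v| ^+ 2)) -mulrBl pmulr_lge0 ?exprn_gt0//.
  by rewrite subr_ge0 => /(lt_le_trans r1); rewrite ltxx.
Qed.

Lemma hpow_coord_norm d H (p : hpow d H) j : `|p j| <= `|p|.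
Proof.
rewrite -(@ler_pXn2r _ 2)// ?nnegrE// -[leRHS]hdotE hpow_dotE.
rewrite (bigD1 j)//= hdotE lerDl; apply: sumr_ge0 => i _.
by rewrite hdotE exprn_ge0.
Qed.

Lemma mx_coord_norm d (D : 'rV[R[i]]_d) j : `|D 0 j| <= `|D|.
Proof.
rewrite [leRHS]/Num.Def.normr /= mx_normE -[leLHS]nngE num_le.
exact: (le_bigmax _ (fun i => `|D i.1 i.2|%:nng) (0, j)).
Qed.

Lemma kernel_eqE (k a b c : R[i]) : 1 - k != 0 ->
  (1 - k)^-1 * (b - c) = a <-> k * a + b = a + c.
Proof.
move=> k1; split=> [<-|e]; first by field.
have -> : b = a + c - k * a by rewrite -e; ring.
by field.
Qed.

(** * Contractive multipliers *)

(** The vector is the elementary tensor of the reproducing vector at [z] with [y]. It equals the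
    Riesz representer of [f |-> '[ev f z, y]] because both have the same inner products with
    elementary tensors, whose closed span is everything. *)
Lemma vrkhs_kernel (T : Type) (Om : set T) (k : T -> T -> R[i])
    (Y E : hilbertType R[i]) (ev : E -> T -> Y) :
  is_vrkhs Om k ev ->
  exists kap : T * Y -> E, forall z y, Om z ->
    (forall f, '[f, kap (z, y)] = '[ev f z, y]) /\
    (forall l, Om l -> ev (kap (z, y)) l = k l z *: y).
Proof.
move=> [H [ev0 [tens [[_ _ rk] [tensE tensT] evl evc evt]]]].
suff /choice[kap kapP] : forall i : T * Y, exists e : E, Om i.1 ->
    (forall f, '[f, e] = '[ev f i.1, i.2]) /\
    (forall l, Om l -> ev e l = k l i.1 *: i.2).
  by exists kap => z y; exact: (kapP (z, y)).
move=> [z y] /=; have [Oz|nOz] := pselect (Om z); last by exists 0.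
have [ks [ksE ksP]] := rk z Oz; exists (tens ks y) => _.
split=> [f|l Ol]; last by rewrite evt// ksE.
have [||e eE] := @riesz E (fun f => '[ev f z, y]).
- by move=> a u v; rewrite evl// hdotDl hdotZl.
- apply: (@preimage_closed _ _ (fun f => ev f z) [set w | '[w, y] = 0]).
    by move=> ? _; exact: evc.
  exact: closed_orth.
rewrite eE; apply/eqP; rewrite -subr_eq0 -hdotBr; apply/eqP.
apply: (@clspan_orth _ _ [set tens f y | f in setT & y in setT]); last first.
  by rewrite tensT.
move=> _ [g _ [y' _ <-]]; rewrite hdotBr -eE tensE evt// hdotZl -ksP.
by rewrite subrr.
Qed.

Lemma multiplier_contraction (T : Type) (Om : set T) (k : T -> T -> R[i])
    (U Y X EU EY : hilbertType R[i]) (evU : EU -> T -> U) (evY : EY -> T -> Y)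
    (S : T -> {linear U -> Y}) (r : T -> Y -> X) :
  (forall l, Om l -> continuous (S l)) ->
  (forall l z y y', Om l -> Om z ->
     k l z * ('[y, y'] - '[adjoint (S z) y, adjoint (S l) y'])
     = '[r z y, r l y']) ->
  is_vrkhs Om k evU -> is_vrkhs Om k evY ->
  forall f : EU, exists g : EY,
    (forall l, Om l -> evY g l = S l (evU f l)) /\ `|g| <= `|f|.
Proof.
move=> Sc kr /vrkhs_kernel[kU kUP] /vrkhs_kernel[kY kYP] f.
(* By [kr] the vectors k_z y and (k_z S(z)^* y, r_z y) have the same Gram
   matrix; [p] is the image of (f, 0) under the adjoint of the resulting isometry. *)
pose Sk (i : T * Y) := kU (i.1, adjoint (S i.1) i.2).
have [|p [_ pE pn]] := @gram_transfer_point (T * Y) [set i | Om i.1] EY (hsum EU X) kY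
  (fun i => (Sk i, r i.1 i.2)) _ (f, 0).
  move=> [z y] [l y'] /= Oz Ol; rewrite hsum_dotE /= /Sk /=.
  have [kUl _] := kUP l (adjoint (S l) y') Ol.
  have [_ kUz] := kUP z (adjoint (S z) y) Oz.
  have [kYl _] := kYP l y' Ol.
  have [_ kYz] := kYP z y Oz.
  by rewrite kYl kYz// kUl kUz// -kr// !hdotZl mulrBr addrC subrK.
exists p; split; last by rewrite -(hsum_norm_l X f).
move=> l Ol; apply/hdotP => y; rewrite adjointE; last exact: Sc.
have [kYl _] := kYP l y Ol; have [kUl _] := kUP l (adjoint (S l) y) Ol.
by rewrite -kYl -kUl hdotC pE// hsum_dotE /= hdot0r addr0 -hdotC.
Qed.

End Hilbert.

(** * The colligation of a contractive pair *)

Section Colligation.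
Variables (R : realType) (d : nat) (U Y X : hilbertType R[i]).
Variables (C : {linear X -> Y}) (A : 'I_d -> {linear X -> X}).
Variables (S : 'rV[R[i]]_d -> {linear U -> Y}).
Hypothesis (C_bounded : continuous C).
Hypothesis (A_bounded : forall j, continuous (A j)).
Hypothesis (CA_contractive : contractive_pair C A).
Implicit Types (l z : 'rV[R[i]]_d).

(** * Norm bounds and adjoints for the column [A] and the row [Z] *)

Lemma contractive_pairE (x : X) :
  \sum_(j < d) `|A j x| ^+ 2 + `|C x| ^+ 2 <= `|x| ^+ 2.
Proof.
have := CA_contractive x.
rewrite hdotBl hdotDl hdot_suml hdotE subr_ge0.
rewrite [X in _ + X <= _]hdotC -adjointE// hdotE rmorphXn /=.
rewrite (conj_Creal (normr_real _)).
under eq_bigr => j _.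
  rewrite hdotC -adjointE// hdotE rmorphXn /= (conj_Creal (normr_real _)).
  over.
by [].
Qed.

Lemma cinner_ge0 l : 0 <= cinner l l.
Proof. by apply: sumr_ge0 => j _; rewrite -normCK exprn_ge0. Qed.

Lemma cinnerE l : cinner l l = \sum_(j < d) `|l 0 j| ^+ 2.
Proof. by apply: eq_bigr => j _; rewrite -normCK. Qed.

(** Termwise, [|l_j| |z_j|] is at most half of the sum of the squares, so [cinner l z] has modulus
    below 1. *)
Lemma cinner_neq1 l z : cball l -> cball z -> 1 - cinner l z != 0.
Proof.
rewrite /cball /= !cinnerE => l1 z1; rewrite subr_eq0 eq_sym; apply/eqP => lz.
have : `|cinner l z| < 1.
  rewrite (le_lt_trans (ler_norm_sum _ _ _))//.
  apply: (@le_lt_trans _ _ (\sum_(j < d) (`|l 0 j| ^+ 2 + `|z 0 j| ^+ 2) / 2)).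
    apply: ler_sum => j _; rewrite normrM norm_conjC ler_pdivlMr//.
    rewrite -subr_ge0.
    have -> : `|l 0 j| ^+ 2 + `|z 0 j| ^+ 2 - `|l 0 j| * `|z 0 j| * 2
      = (`|l 0 j| - `|z 0 j|) ^+ 2 by ring.
    by rewrite -realEsqr realB.
  rewrite -mulr_suml big_split /= ltr_pdivrMr// mul1r.
  by rewrite [ltRHS]mulr2n ltrD.
by rewrite lz normr1 ltxx.
Qed.

Lemma Acol_norm (x : X) : `|Acol A x| <= `|x|.
Proof.
rewrite -(@ler_pXn2r _ 2)// ?nnegrE// -[leLHS]hdotE hpow_dotE.
apply: le_trans (contractive_pairE x).
rewrite -[leLHS]addr0 lerD ?exprn_ge0//.
by apply: ler_sum => j _; rewrite ffunE hdotE.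
Qed.

Lemma C_norm (x : X) : `|C x| <= `|x|.
Proof.
rewrite -(@ler_pXn2r _ 2)// ?nnegrE//; apply: le_trans (contractive_pairE x).
by rewrite lerDr; apply: sumr_ge0 => j _; rewrite exprn_ge0.
Qed.

Lemma adjoint_Acol (p : hpow d X) :
  adjoint (Acol A) p = \sum_(j < d) adjoint (A j) (p j).
Proof.
apply: adjoint_uniq => x; rewrite hpow_dotE hdot_sumr; apply: eq_bigr => j _.
by rewrite ffunE adjointE.
Qed.

Lemma adjoint_AcolE (x : X) (p : hpow d X) :
  '[Acol A x, p] = '[x, adjoint (Acol A) p].
Proof.
rewrite adjoint_Acol hpow_dotE hdot_sumr; apply: eq_bigr => j _.
by rewrite ffunE adjointE.
Qed.

Lemma adjoint_Acol_lin (a : R[i]) p q : adjoint (Acol A) (a *: p + q) =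
  a *: adjoint (Acol A) p + adjoint (Acol A) q.
Proof.
by apply: adjoint_uniq => x; rewrite !hdotDr !hdotZr !adjoint_AcolE.
Qed.

Lemma adjoint_Acol_norm p : `|adjoint (Acol A) p| <= `|p|.
Proof.
apply: le_of_sqr_le => //.
rewrite -[leLHS](ger0_norm (exprn_ge0 2 (normr_ge0 _))) -hdotE -adjoint_AcolE.
by rewrite (le_trans (hdot_CS _ _))// mulrC ler_wpM2l// Acol_norm.
Qed.

Lemma adjoint_Zrow z (x : X) :
  adjoint (@Zrow _ d X z) x = [ffun j => (z 0 j)^* *: x].
Proof.
apply: adjoint_uniq => p; rewrite /Zrow hdot_suml; apply: eq_bigr => j _.
by rewrite ffunE hdotZl hdotZr conjCK.
Qed.

Lemma adjoint_ZrowE z (x : X) p :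
  '[Zrow z p, x] = '[p, adjoint (@Zrow _ d X z) x].
Proof.
rewrite adjoint_Zrow /Zrow hdot_suml; apply: eq_bigr => j _.
by rewrite ffunE hdotZl hdotZr conjCK.
Qed.

Lemma dot_adjoint_Zrow l z (x y : X) :
  '[adjoint (@Zrow _ d X z) x, adjoint (@Zrow _ d X l) y] = cinner l z * '[x, y].
Proof.
rewrite !adjoint_Zrow hpow_dotE mulr_suml; apply: eq_bigr => j _.
by rewrite !ffunE hdotZl hdotZr conjCK mulrA [_^* * _]mulrC.
Qed.

(** The Euclidean norm; the norm [|l|] of a row vector is the maximum norm. *)
Definition l2norm l : R[i] := sqrtC (cinner l l).

Lemma l2norm_ge0 l : 0 <= l2norm l.
Proof. by rewrite sqrtC_ge0 cinner_ge0. Qed.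

Lemma l2norm_lt1 l : cball l -> l2norm l < 1.
Proof. by move=> l1; rewrite -sqrtC1 ltr_sqrtC ?nnegrE ?cinner_ge0. Qed.

Lemma adjoint_Zrow_norm z (x : X) :
  `|adjoint (@Zrow _ d X z) x| = l2norm z * `|x|.
Proof.
apply/eqP; rewrite -(@eqrXn2 _ 2)// ?mulr_ge0 ?l2norm_ge0//.
by rewrite -hdotE dot_adjoint_Zrow exprMn sqrtCK hdotE.
Qed.

Lemma Zrow_norm l (p : hpow d X) : `|Zrow l p| <= l2norm l * `|p|.
Proof.
apply: le_of_sqr_le; rewrite ?mulr_ge0 ?l2norm_ge0//.
rewrite -[leLHS](ger0_norm (exprn_ge0 2 (normr_ge0 _))) -hdotE adjoint_ZrowE.
by rewrite (le_trans (hdot_CS _ _))// adjoint_Zrow_norm mulrCA mulrA.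
Qed.

(** * The operators [Z(l) A], their adjoints and resolvents *)

Definition ZA l (x : X) : X := \sum_(j < d) l 0 j *: A j x.

Lemma ZAE l x : ZA l x = Zrow l (Acol A x).
Proof. by apply: eq_bigr => j _; rewrite ffunE. Qed.

Lemma ZA_lin l a u v : ZA l (a *: u + v) = a *: ZA l u + ZA l v.
Proof.
rewrite /ZA scaler_sumr -big_split /=; apply: eq_bigr => j _.
by rewrite linearP scalerDr !scalerA mulrC.
Qed.

Lemma ZA_norm l x : `|ZA l x| <= l2norm l * `|x|.
Proof.
by rewrite ZAE (le_trans (Zrow_norm _ _))// ler_wpM2l ?l2norm_ge0 ?Acol_norm.
Qed.

(* [A^* Z(z)^*], the adjoint of [ZA z = Z(z) A]. *)
Definition ZAadj z (x : X) : X := adjoint (Acol A) (adjoint (@Zrow _ d X z) x).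

Lemma ZAadjE z x : ZAadj z x = \sum_(j < d) (z 0 j)^* *: adjoint (A j) x.
Proof.
rewrite /ZAadj adjoint_Zrow adjoint_Acol; apply: eq_bigr => j _.
rewrite ffunE; apply/hdotP => v; rewrite hdotC -adjointE//.
by rewrite hdotZr conjCK hdotZl adjointE// rmorphM /= -hdotC.
Qed.

Lemma ZA_adjE l x y : '[ZA l x, y] = '[x, ZAadj l y].
Proof. by rewrite ZAE adjoint_ZrowE adjoint_AcolE. Qed.

Lemma ZAadj_lin l a u v : ZAadj l (a *: u + v) = a *: ZAadj l u + ZAadj l v.
Proof.
apply/hdotP => w; rewrite hdotC -ZA_adjE hdotDr hdotZr !ZA_adjE.
by rewrite rmorphD rmorphM /= conjCK -!hdotC hdotDl hdotZl.
Qed.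

Lemma ZAadj_norm l x : `|ZAadj l x| <= l2norm l * `|x|.
Proof.
apply: le_of_sqr_le; rewrite ?mulr_ge0 ?l2norm_ge0//.
rewrite -[leLHS](ger0_norm (exprn_ge0 2 (normr_ge0 _))) -hdotE -ZA_adjE.
rewrite (le_trans (hdot_CS _ _))// mulrAC ler_wpM2r// ZA_norm//.
Qed.

Definition resolvent l := opinv (fun x => x - ZA l x).

Lemma resolventK l : cball l -> cancel (resolvent l) (fun x => x - ZA l x).
Proof.
by move=> l1; have [] := opinv_contractionK (ZA_lin l) (l2norm_lt1 l1) (ZA_norm l).
Qed.

Lemma resolventVK l : cball l -> cancel (fun x => x - ZA l x) (resolvent l).
Proof.
by move=> l1; have [] := opinv_contractionK (ZA_lin l) (l2norm_lt1 l1) (ZA_norm l).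
Qed.

Lemma rvecE z y : cball z -> rvec C A z y - ZAadj z (rvec C A z y) = adjoint C y.
Proof.
move=> z1; apply: (proj1 (opinv_contractionK (ZAadj_lin z) (l2norm_lt1 z1) _)).
exact: ZAadj_norm.
Qed.

(** Writing [adjoint C y] as [I - ZAadj l] applied to [rvec C A l y] and moving this factor to the
    left argument cancels the resolvent. *)
Lemma resolvent_adj l x y : cball l -> '[C (resolvent l x), y] = '[x, rvec C A l y].
Proof.
move=> l1; rewrite adjointE// -(rvecE y l1) hdotBr -ZA_adjE -hdotBl.
by rewrite resolventK.
Qed.

Lemma KCAE l z y y' : cball l -> cball z ->
  '[KCA C A l z y, y'] = '[rvec C A z y, rvec C A l y'].
Proof.
move=> l1 z1; rewrite -resolvent_adj//; congr '[C (resolvent l _), _].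
rewrite /rvec; congr (opinv _ _); apply/funext => x.
by rewrite -ZAadjE.
Qed.

Lemma dot_Dgen l z y y' :
  '[Dgen C A z y, Dgen C A l y'] = cinner l z * '[rvec C A z y, rvec C A l y'].
Proof. exact: dot_adjoint_Zrow. Qed.

Lemma Dgen0 y : Dgen C A 0 y = 0.
Proof.
rewrite /Dgen adjoint_Zrow; apply/ffunP => j.
by rewrite !ffunE mxE rmorph0 scale0r.
Qed.

Lemma cball0 : cball (0 : 'rV[R[i]]_d).
Proof. by rewrite /cball /= cinnerE big1// => j _; rewrite mxE normr0 expr0n. Qed.

Lemma rvec0 y : rvec C A 0 y = adjoint C y.
Proof.
have := rvecE y cball0; rewrite /ZAadj.
rewrite adjoint_Zrow adjoint_Acol big1 ?subr0// => j _.
rewrite ffunE mxE rmorph0 scale0r; apply: adjoint_uniq => x.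
by rewrite !hdot0r.
Qed.

(** * The kernel identity as an equality of Gram matrices *)

Hypothesis (S_bounded : forall l, cball l -> continuous (S l)).

(* The kernel identity K_S = K_(C,A) cleared of its denominator: the vectors
   (Z(z)^* r, y) and (r, S(z)^* y), with r = (I - A^* Z(z)^* )^-1 C^* y, have
   the same Gram matrix. *)
Definition gram : Prop := forall l z y y', cball l -> cball z ->
  '[Dgen C A z y, Dgen C A l y'] + '[y, y'] =
  '[rvec C A z y, rvec C A l y'] + '[adjoint (S z) y, adjoint (S l) y'].

Lemma gramE : gram <-> forall l z y y', cball l -> cball z ->
  kd l z * ('[y, y'] - '[adjoint (S z) y, adjoint (S l) y']) =
  '[rvec C A z y, rvec C A l y'].
Proof.
split=> h l z y y' l1 z1; have := h l z y y' l1 z1; rewrite dot_Dgen.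
  by move/kernel_eqE; apply; exact: cinner_neq1.
by rewrite kernel_eqE//; exact: cinner_neq1.
Qed.

Lemma gramP : (forall l z, cball l -> cball z -> KS S l z =1 KCA C A l z) <-> gram.
Proof.
have KSE l z y y' : cball l -> cball z -> '[KS S l z y, y'] =
    kd l z * ('[y, y'] - '[adjoint (S z) y, adjoint (S l) y']).
  move=> l1 z1; rewrite /KS hdotZl hdotBl; congr (_ * (_ - _)).
  by rewrite adjointE//; exact: S_bounded.
rewrite gramE; split=> [K l z y y' l1 z1|K l z l1 z1 y].
  by rewrite -KSE// K// KCAE.
by apply/hdotP => y'; rewrite KSE// KCAE// K.
Qed.

(** * Equality of Gram matrices and the isometry V *)

Let J : set ('rV[R[i]]_d * Y) := [set i | cball i.1].
Definition invec (i : 'rV[R[i]]_d * Y) : hsum (hpow d X) Y :=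
  (Dgen C A i.1 i.2, i.2).
Definition outvec (i : 'rV[R[i]]_d * Y) : hsum X U :=
  (rvec C A i.1 i.2, adjoint (S i.1) i.2).

Lemma RVspaceE : RVspace C A S = clspan (outvec @` J).
Proof.
congr clspan; apply/seteqP; split=> [_ [z z1 [y _ <-]]|_ [[z y] z1 <-]].
  by exists (z, y).
by exists z => //; exists y.
Qed.

Lemma Dspace_gen z y : cball z -> Dspace C A (Dgen C A z y).
Proof. by move=> z1; apply: clspan_mem; exists z => //; exists y. Qed.

(* At z = 0 the generator (Dgen z y, y) is (0, y), so that the generators span
   D (+) Y and not only a graph over D. *)
Lemma clspan_invec p : clspan (invec @` J) p <-> Dspace C A p.1.
Proof.
split=> h; apply: clspan_biorth => v vg.
  have : '[p, ((v, 0) : hsum (hpow d X) Y)] = 0.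
    apply: clspan_orth h => _ [[z y] z1 <-].
    by rewrite hsum_dotE /= hdot0r addr0 vg//; exists z => //; exists y.
  by rewrite hsum_dotE /= hdot0r addr0.
have v20 : v.2 = 0.
  apply: hdot_eq0.
  have := vg _ (ex_intro2 _ _ (0, v.2) cball0 erefl).
  by rewrite hsum_dotE /invec /= Dgen0// hdot0l add0r.
rewrite hsum_dotE v20 hdot0r addr0.
apply: clspan_orth h => _ [z z1 [y _ <-]].
have := vg _ (ex_intro2 _ _ (z, y) z1 erefl).
by rewrite hsum_dotE /= v20 hdot0r addr0.
Qed.

Lemma gram_vec : gram -> forall i j, J i -> J j ->
  '[invec i, invec j] = '[outvec i, outvec j].
Proof. by move=> g [z y] [l y'] z1 l1; rewrite !hsum_dotE; exact: g. Qed.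

(** The first entry is the defining equation of [rvec]; in the second the two terms with [S 0]
    cancel. *)
Lemma Vop_invec CV z y : is_CV C A S CV -> cball z ->
  Vop C A S CV (invec (z, y)) = outvec (z, y).
Proof.
move=> [_ _ CVg] z1; rewrite /Vop /outvec /= CVg// subrK.
by congr pair; rewrite -(rvecE y z1) addrC subrK.
Qed.

Lemma V_isometry_gram : V_isometry C A S -> gram.
Proof.
move=> [CV [CVP [iso _]]] l z y y' l1 z1.
have Vl (a : R[i]) (u v : hsum (hpow d X) Y) : Dspace C A u.1 -> Dspace C A v.1 ->
    Vop C A S CV (a *: u + v) = a *: Vop C A S CV u + Vop C A S CV v.
  move=> Du Dv; rewrite /Vop; have [CVl _ _] := CVP.
  congr pair; rewrite /=.
    by rewrite adjoint_linear// adjoint_Acol_lin// scalerDr addrACA.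
  rewrite CVl// adjoint_linear ?scalerDr 1?addrACA//.
  by apply: S_bounded; exact: cball0.
have := @polarization _ (hsum (hpow d X) Y) _ (Vop C A S CV)
  [set p : hsum (hpow d X) Y | Dspace C A p.1] _ Vl iso (invec (z, y)) (invec (l, y')).
rewrite !Vop_invec// !hsum_dotE /= => -> //.
- by move=> a u v /= Du Dv; exact: clspan_lin.
- exact: Dspace_gen.
- exact: Dspace_gen.
Qed.

(** [W] is the desired isometry preceded by the projection onto the span of the [invec i], and [W']
    is its adjoint. Testing against generators shows that they are mutually inverse on the two
    closed spans. C_V is read off from the second component of [W]. *)
Lemma gram_V_isometry : gram -> V_isometry C A S.
Proof.
move=> g.
have [W WP] := @gram_transfer _ _ J _ _ outvec invec
  (fun i j Ji Jj => esym (gram_vec g Ji Jj)).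
have [W' WP'] := @gram_transfer _ _ J _ _ invec outvec (gram_vec g).
have WK v : clspan (invec @` J) v -> W' (W v) = v.
  move=> Gv; apply: (@clspan_eq _ _ (invec @` J)) => //; first by case: (WP' (W v)).
  move=> _ [i Ji <-]; have [_ -> // _] := WP' (W v).
  by have [_ -> // _] := WP v.
have WK' v : clspan (outvec @` J) v -> W (W' v) = v.
  move=> Gv; apply: (@clspan_eq _ _ (outvec @` J)) => //; first by case: (WP (W' v)).
  move=> _ [i Ji <-]; have [_ -> // _] := WP (W' v).
  by have [_ -> // _] := WP' v.
have Wg i : J i -> W (invec i) = outvec i.
  move=> Ji; apply: (@clspan_eq _ _ (outvec @` J)) => //.
  - by case: (WP (invec i)).
  - by apply: clspan_mem; exists i.
  move=> _ [j Jj <-]; have [_ -> // _] := WP (invec i).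
  exact: gram_vec.
have Wn v : `|W v| <= `|v| by case: (WP v).
pose emb (p : hpow d X) : hsum (hpow d X) Y := (p, 0).
have embl a u v : emb (a *: u + v) = a *: emb u + emb v.
  by congr pair; rewrite /= scaler0 addr0.
pose CV p := (W (emb p)).2.
have W0 y : W (0, y) = (adjoint C y, adjoint (S 0) y).
  have := Wg (0, y) cball0.
  by rewrite /invec /outvec /= Dgen0// rvec0.
(* [(Dgen C A z y, 0)] is the difference of the generators at [z] and at [0], which explains the
   subtraction of [adjoint (S 0) y] in C_V. *)
have Wemb z y : cball z -> W (emb (Dgen C A z y)) = outvec (z, y) - outvec (0, y).
  move=> z1; rewrite -!Wg//; last exact: cball0.
  rewrite -linearB; congr (W _); congr pair => /=; last by rewrite subrr.
  by rewrite Dgen0// subr0.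
have CVl a u v : CV (a *: u + v) = a *: CV u + CV v.
  by rewrite /CV embl linearP.
have CVP : is_CV C A S CV.
  split.
  - by move=> a u v _ _; exact: CVl.
  - apply: continuous_subspaceT; apply: (@bounded_linear_continuous _ _ _ CV 1) => //.
    move=> x; rewrite mul1r (le_trans (hsum_norm2 _))//.
    by rewrite (le_trans (Wn _))// hsum_norm_l.
  - by move=> z y z1; rewrite /CV Wemb.
(* The restriction to D matters: [W] vanishes on the orthogonal complement of the generators,
   whereas [adjoint (Acol A)] need not. *)
have W1 p : Dspace C A p -> (W (emb p)).1 = adjoint (Acol A) p.
  pose T p := (W (emb p)).1 - adjoint (Acol A) p.
  have Tl a u v : T (a *: u + v) = a *: T u + T v.
    by rewrite /T embl linearP adjoint_Acol_lin//= opprD addrACA scalerBr.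
  have Tn q : `|T q| <= 2 * `|q|.
    rewrite (le_trans (ler_normB _ _))// mulrDl mul1r lerD//; last first.
      exact: adjoint_Acol_norm.
    by rewrite (le_trans (hsum_norm1 _))// (le_trans (Wn _))// hsum_norm_l.
  have T0 : T 0 = 0 by have := Tl (-1) 0 0; rewrite scaler0 addr0 scaleN1r addNr.
  move=> Dp; apply/eqP; rewrite -subr_eq0; apply/eqP.
  apply: (_ : Dspace C A `<=` [set q | T q = 0]) => //.
  apply: clspan_sub => //.
  - move=> _ [z z1 [y _ <-]] /=; rewrite /T Wemb//= rvec0//.
    rewrite -(rvecE y z1).
    by rewrite opprB addrCA subrr addr0 subrr.
  - by move=> a u v /= u0 v0; rewrite Tl u0 v0 scaler0 addr0.
  - by apply: closed_kernel; exact: bounded_linear_continuous Tl _ Tn.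
have VW p : Dspace C A p.1 -> Vop C A S CV p = W p.
  case: p => p q /= Dp.
  have -> : W (p, q) = W (emb p) + W (0, q).
    by rewrite -linearD; congr (W _); congr pair; rewrite /= ?addr0 ?add0r.
  by rewrite W0 [W (emb p)]surjective_pairing W1.
exists CV; split=> //; split.
  (* [W] and [W'] are contractions and [W'] undoes [W] here, so [W] preserves the norm. *)
  move=> p Dp; rewrite VW//; apply/eqP; rewrite eq_le Wn /=.
  have [_ _] := WP' (W p); rewrite WK//; exact/clspan_invec.
rewrite RVspaceE; apply/seteqP; split=> [_ [p Dp <-]|v Gv].
  by rewrite VW//; case: (WP p).
exists (W' v); first by apply/clspan_invec; case: (WP' v).
rewrite VW ?WK'//; apply/clspan_invec; by case: (WP' v).
Qed.

(** * Perturbation of the resolvent, and membership in the Schur class *)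

Lemma Zrow_lin l (a : R[i]) (p q : hpow d X) :
  Zrow l (a *: p + q) = a *: Zrow l p + Zrow l q.
Proof.
rewrite /Zrow scaler_sumr -big_split /=; apply: eq_bigr => j _.
by rewrite !ffunE scalerDr !scalerA mulrC.
Qed.

Lemma ZrowB l z (p : hpow d X) : Zrow (l - z) p = Zrow l p - Zrow z p.
Proof.
rewrite /Zrow -sumrB; apply: eq_bigr => j _.
by rewrite !mxE scalerBl.
Qed.

Lemma ZAB l z x : ZA l x - ZA z x = Zrow (l - z) (Acol A x).
Proof. by rewrite !ZAE ZrowB. Qed.

Lemma resolvent_lin l (a : R[i]) x y : cball l ->
  resolvent l (a *: x + y) = a *: resolvent l x + resolvent l y.
Proof.
move=> l1; rewrite -[RHS](resolventVK l1).
congr (resolvent l _); rewrite ZA_lin opprD addrACA -scalerBr.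
by rewrite !(resolventK l1).
Qed.

(** The resolvent identity, checked by applying [I - ZA l] to both sides. *)
Lemma resolvent_sub l z x : cball l -> cball z ->
  resolvent l x - resolvent z x = resolvent l (Zrow (l - z) (Acol A (resolvent z x))).
Proof.
move=> l1 z1.
rewrite -[LHS](resolventVK l1); congr (resolvent l _).
have LB u v : ZA l (u - v) = ZA l u - ZA l v.
  by rewrite addrC -scaleN1r ZA_lin scaleN1r addrC.
have e : resolvent l x - ZA l (resolvent l x) = resolvent z x - ZA z (resolvent z x).
  by rewrite (resolventK l1) (resolventK z1).
rewrite LB opprB [ZA l _ - _]addrC addrACA e -ZAB.
by rewrite addrACA subrr add0r addrC.
Qed.

(** The constant [d.+1] replaces the square root of [d]: it is a natural number and stays positive
    for [d = 0]. *)
Lemma l2norm_le (D : 'rV[R[i]]_d) : l2norm D <= d.+1%:R * `|D|.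
Proof.
rewrite -(@ler_pXn2r _ 2)// ?nnegrE ?l2norm_ge0 ?mulr_ge0//.
rewrite sqrtCK cinnerE exprMn.
apply: (@le_trans _ _ (\sum_(j < d) `|D| ^+ 2)).
  by apply: ler_sum => j _; rewrite ler_pXn2r ?nnegrE ?mx_coord_norm.
rewrite sumr_const card_ord -[_ *+ d]mulr_natl ler_wpM2r ?exprn_ge0//.
by rewrite -natrX ler_nat (leq_trans (leqnSn d))// leq_pmulr.
Qed.

(** Since [|l0 0 j|] and [|l - l0|] are at most 1, each squared coordinate grows by at most
    [3 * |l - l0|]; sum over the [d] coordinates. *)
Lemma cball_near l0 l : cball l0 -> `|l - l0| <= 1 ->
  3 * d.+1%:R * `|l - l0| < 1 - cinner l0 l0 -> cball l.
Proof.
rewrite /cball /= !cinnerE => l01; set del := `|l - l0| => d1 h.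
have del0 : 0 <= del by exact: normr_ge0.
have l0j j : `|l0 0 j| <= 1.
  rewrite -(@ler_pXn2r _ 2)// ?nnegrE// expr1n (le_trans _ (ltW l01))//.
  by rewrite (bigD1 j)//= lerDl sumr_ge0// => i _; rewrite exprn_ge0.
apply: (@le_lt_trans _ _ (\sum_(j < d) (`|l0 0 j| ^+ 2 + 3 * del))).
  apply: ler_sum => j _.
  apply: (@le_trans _ _ ((`|l0 0 j| + del) ^+ 2)).
    rewrite ler_pXn2r ?nnegrE ?addr_ge0//.
    have -> : l 0 j = l0 0 j + (l - l0) 0 j by rewrite !mxE addrCA subrr addr0.
    by rewrite (le_trans (ler_normD _ _))// lerD2l mx_coord_norm.
  rewrite sqrrD -addrA lerD2l (_ : 3 * del = (1 * del) *+ 2 + del * 1); last by ring.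
  by rewrite lerD// ?lerMn2r /= ?ler_wpM2r// expr2 ler_wpM2l.
rewrite big_split /= sumr_const card_ord -[_ *+ d]mulr_natl mulrA.
rewrite -ltrBrDl; apply: le_lt_trans h.
by rewrite ler_wpM2r// mulrC ler_wpM2l// ler_nat.
Qed.

(** [ZA l] is [ZA l0] plus a perturbation of norm at most [h], hence has norm at most [1 - h]. The
    resulting bound [h^-1] is uniform in [l] near [l0]. *)
Lemma resolvent_bound l0 l h x : 0 < h ->
  l2norm l0 <= 1 - 2 * h -> l2norm (l - l0) <= h ->
  cball l -> h * `|resolvent l x| <= `|x|.
Proof.
move=> h0 l0h lh l1; set v := resolvent l x.
have vE : v - ZA l v = x by exact: resolventK.
have Lv : `|ZA l v| <= (1 - h) * `|v|.
  rewrite -(subrK (ZA l0 v) (ZA l v)) ZAB.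
  rewrite (_ : (1 - h) * `|v| = h * `|v| + (1 - 2 * h) * `|v|); last by ring.
  rewrite (le_trans (ler_normD _ _))// lerD//.
    rewrite (le_trans (Zrow_norm _ _))//.
    rewrite (le_trans (ler_wpM2l (l2norm_ge0 _) (Acol_norm v)))//.
    by rewrite ler_wpM2r.
  rewrite (le_trans (ZA_norm _ _))//.
  by rewrite ler_wpM2r.
have : `|v| <= `|x| + `|ZA l v| by rewrite -vE -{1}(subrK (ZA l v) v) ler_normD.
rewrite -lerBlDr; apply: le_trans.
by rewrite lerBrDr (le_trans (lerD (lexx _) Lv))// -mulrDl addrC subrK mul1r.
Qed.

(* [B] is the adjoint of C_V composed with the projection onto D. *)
Lemma gram_realization : gram ->
  exists B : {linear U -> hpow d X}, (forall u, `|B u| <= `|u|) /\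
    forall l u, cball l -> S l u = S 0 u + C (resolvent l (Zrow l (B u))).
Proof.
move=> g.
have [W WP] := gram_transfer (gram_vec g).
have [|B BE] := @linear_bundle _ _ _ (fun u : U => (W (0, u)).1).
  move=> a u v.
  have -> : ((0, a *: u + v) : hsum X U) =
      a *: ((0, u) : hsum X U) + ((0, v) : hsum X U).
    by congr pair; rewrite /= scaler0 addr0.
  by rewrite linearP.
exists B; split=> [u|l u l1].
  rewrite BE (le_trans (hsum_norm1 _))//.
  by have [_ _] := WP (0, u); rewrite hsum_norm_r.
(* [W] is the adjoint of V, so pairing [W (0, u)] with the generator at [z] gives
   ['[adjoint (S z) y, u]]. At [z = 0] only the second component remains. *)
have Sl z y : cball z -> '[Dgen C A z y, B u] + '[y, (W (0, u)).2] = '[y, S z u].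
  move=> z1; have [_ /(_ (z, y) z1) + _] := WP (0, u).
  rewrite !hsum_dotE /= BE => ->.
  rewrite hdot0r add0r hdotC -adjointE; last exact: S_bounded.
  by rewrite -hdotC.
have S0 : (W (0, u)).2 = S 0 u.
  apply/hdotP => y; rewrite hdotC [RHS]hdotC -Sl ?Dgen0 ?hdot0l ?add0r//.
  exact: cball0.
apply/hdotP => y; rewrite hdotC -Sl// S0 rmorphD /= -!hdotC hdotDl addrC; congr (_ + _).
by rewrite /Dgen -adjoint_ZrowE// resolvent_adj.
Qed.

Lemma gram_analytic : gram -> op_analytic S.
Proof.
move=> /gram_realization[B [Bn SB]] l0 l01.
(* Half of the gap, so that [l2norm l0 = 1 - 2 * h] as [resolvent_bound] requires. *)
pose h : R[i] := (1 - l2norm l0) / 2.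
have h0 : 0 < h by rewrite divr_gt0// subr_gt0 l2norm_lt1.
have l0h : l2norm l0 <= 1 - 2 * h.
  by rewrite mulrC divfK ?pnatr_eq0// opprB addrC subrK.
have R0 x : `|resolvent l0 x| <= h^-1 * `|x|.
  rewrite ler_pdivlMl//; apply: resolvent_bound l0h _ l01 => //.
  have -> : l2norm (l0 - l0) = 0.
    by rewrite subrr /l2norm cinnerE big1 ?sqrtC0// => j _; rewrite mxE normr0 expr0n.
  exact: ltW.
have bl01 : l2norm l0 <= 1 by rewrite ltW// l2norm_lt1.
(* R(l) Z(l) - R(l0) Z(l0) = R(l) Z(l - l0) (I + A R(l0) Z(l0)), so that the
   derivative is [L] below and the remainder is
   C R(l) Z(l - l0) A R(l0) Z(l - l0) q. *)
pose q u : hpow d X := B u + Acol A (resolvent l0 (Zrow l0 (B u))).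
have qn u : `|q u| <= (1 + h^-1) * `|u|.
  rewrite mulrDl mul1r (le_trans (ler_normD _ _))// lerD//.
  rewrite (le_trans (Acol_norm _))//.
  rewrite (le_trans (R0 _))// ler_wpM2l ?invr_ge0 ?(ltW h0)//.
  rewrite (le_trans (Zrow_norm _ _))// (le_trans _ (Bn u))//.
  by rewrite -[leRHS]mul1r ler_wpM2r.
have Acol_lin (a : R[i]) x y : Acol A (a *: x + y) = a *: Acol A x + Acol A y.
  by apply/ffunP => j; rewrite !ffunE linearP.
have ql (a : R[i]) u v : q (a *: u + v) = a *: q u + q v.
  by rewrite /q linearP Zrow_lin resolvent_lin// Acol_lin scalerDr addrACA.
have /choice[L LE] : forall j, exists L : {linear U -> Y},
    forall u, L u = C (resolvent l0 (q u j)).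
  move=> j; apply: linear_bundle => a u v.
  by rewrite ql !ffunE resolvent_lin// linearP.
have hi0 : 0 < h^-1 by rewrite invr_gt0.
exists L; split.
  move=> j; apply: (@bounded_linear_continuous _ _ _ _ (h^-1 * (1 + h^-1))).
  - by move=> a u v; rewrite linearP.
  - by rewrite mulr_gt0// addr_gt0.
  - move=> u; rewrite LE (le_trans (C_norm _))//.
    rewrite (le_trans (R0 _))// -mulrA ler_wpM2l// ?(ltW hi0)//.
    by rewrite (le_trans _ (qn u))// hpow_coord_norm.
move=> e e0.
pose D : R[i] := d.+1%:R.
have D0 : 0 < D by rewrite ltr0n.
(* The product of the bounds for the two resolvents, the two factors [Zrow (l - l0)] and [q]; [C]
   and [Acol A] are contractions. *)
pose c := h^-1 * D * (h^-1 * D) * (1 + h^-1).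
have c0 : 0 < c by rewrite !mulr_gt0// addr_gt0.
have nearb b : 0 < b -> \forall l \near l0, `|l - l0| < b.
  move=> b0; have := nbhsx_ballx l0 b b0.
  by rewrite -ball_normE; apply: filterS => l /=; rewrite distrC.
have l0' : 0 < 1 - cinner l0 l0 by rewrite subr_gt0.
(* [d1] and [db] keep [l] in the ball, [dh] bounds the resolvent at [l], and [de] absorbs one factor
   [|l - l0|] of the quadratic remainder into [e]. *)
near=> l.
have d1 : `|l - l0| < 1 by near: l; exact: nearb.
have dh : `|l - l0| < h / D by near: l; apply: nearb; rewrite divr_gt0.
have db : `|l - l0| < (1 - cinner l0 l0) / (3 * D).
  by near: l; apply: nearb; rewrite divr_gt0// mulr_gt0.
have de : `|l - l0| < e / c by near: l; apply: nearb; rewrite divr_gt0.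
have l1 : cball l.
  apply: (cball_near l01 (ltW d1)).
  by rewrite mulrC -ltr_pdivlMr// mulr_gt0.
have bD : l2norm (l - l0) <= D * `|l - l0| by exact: l2norm_le.
have bh : l2norm (l - l0) <= h.
  by rewrite (le_trans bD)// mulrC -ler_pdivlMr// ltW.
have R1 x : `|resolvent l x| <= h^-1 * `|x|.
  by rewrite ler_pdivlMl//; apply: resolvent_bound l0h _ l1.
move=> u.
have -> : S l u - S l0 u - \sum_(j < d) (l 0 j - l0 0 j) *: L j u =
  C (resolvent l (Zrow (l - l0) (Acol A (resolvent l0 (Zrow (l - l0) (q u)))))).
  have [Rl RlE] := linear_bundle (fun a x y => resolvent_lin a x y l1).
  have [Rl0 Rl0E] := linear_bundle (fun a x y => resolvent_lin a x y l01).
  have [Zd ZdE] := linear_bundle (Zrow_lin (l - l0)).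
  have -> : \sum_(j < d) (l 0 j - l0 0 j) *: L j u =
      C (resolvent l0 (Zrow (l - l0) (q u))).
    rewrite -Rl0E /Zrow !linear_sum; apply: eq_bigr => j _.
    by rewrite !linearZ /= LE Rl0E !mxE.
  rewrite -(resolvent_sub _ l1 l01) linearB /=; congr (_ - _).
  rewrite (SB l u l1) (SB l0 u l01) opprD addrACA subrr add0r -linearB.
  congr (C _).
  have RD x y : resolvent l (x + y) = resolvent l x + resolvent l y.
    by rewrite -!RlE linearD.
  have RB x y : resolvent l (x - y) = resolvent l x - resolvent l y.
    by rewrite -!RlE linearB.
  rewrite -ZdE linearD !ZdE RD -resolvent_sub// ZrowB RB.
  by rewrite addrA subrK.
rewrite (le_trans (C_norm _))//.
apply: (@le_trans _ _ (c * `|l - l0| ^+ 2 * `|u|)); last first.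
  rewrite ler_wpM2r// expr2 mulrA ler_wpM2r// mulrC -ler_pdivlMr//.
  exact: ltW.
have Zn (p : hpow d X) : `|Zrow (l - l0) p| <= D * `|l - l0| * `|p|.
  by rewrite (le_trans (Zrow_norm _ _))// ler_wpM2r.
have Dl0 : 0 <= D * `|l - l0| by rewrite mulr_ge0// ltW.
rewrite (le_trans (R1 _))//.
have -> : c * `|l - l0| ^+ 2 * `|u| =
  h^-1 * (D * `|l - l0| * (h^-1 * (D * `|l - l0| * ((1 + h^-1) * `|u|)))).
  by rewrite /c; ring.
rewrite ler_wpM2l ?(ltW hi0)// (le_trans (Zn _))// ler_wpM2l//.
rewrite (le_trans (Acol_norm _))//.
rewrite (le_trans (R0 _))// ler_wpM2l ?(ltW hi0)// (le_trans (Zn _))//.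
by rewrite ler_wpM2l.
Unshelve. all: by end_near. Qed.

Lemma gram_schur : gram -> schur_class S.
Proof.
move=> g; split; first exact: gram_analytic.
move=> EU EY evU evY.
apply: (@multiplier_contraction _ _ _ _ _ _ X _ _ _ _ _ (rvec C A)) => //.
exact/gramE.
Qed.

End Colligation.

Theorem lemma2p3 (R : realType) (d : nat) (U Y X : hilbertType R[i])
    (C : {linear X -> Y}) (A : 'I_d -> {linear X -> X})
    (S : 'rV[R[i]]_d -> {linear U -> Y})
    (C_bounded : continuous C)
    (A_bounded : forall j, continuous (A j))
    (S_bounded : forall l, cball l -> continuous (S l))
    (CA_contractive : contractive_pair C A) :
  ((forall l z, cball l -> cball z -> KS S l z =1 KCA C A l z)
     <-> V_isometry C A S) /\
  ((forall l z, cball l -> cball z -> KS S l z =1 KCA C A l z) ->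
     schur_class S).
Proof.
have K := gramP C_bounded A_bounded CA_contractive S_bounded.
split; last by move/K; exact: gram_schur.
split=> [/K|].
  exact: gram_V_isometry.
by move/(V_isometry_gram C_bounded A_bounded CA_contractive S_bounded)/K.
Qed.
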